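(* Let $G$ be the Galois group of an extension of local fields $L/K$, with $L=k((t))$, with ramification filtration $(G_i)$, and let $(t_\lambda)_{1\leq \lambda \leq f}$ be the sequence of jumps of the ramification filtration of $G_1$, that is, \[ G_1=\cdots =G_{t_f}>G_{t_f+1}=\cdots=G_{t_{f-1}}>G_{t_{f-1}+1} \geq \cdots \geq G_{t_1}=G_{n}> G_{n+1}=\{1\}, \] with the convention $G_{t_0}=G_{n+1}=\{1\}$. Let $\mathcal{T}_{\mathcal{O}}=k[[t]]\frac{d}{dt}$. Then \[ \dim_k H^1\big(G_1/G_{t_{f-1}},\mathcal{T}_{\mathcal{O}}^{G_{t_{f-1}}}\big) \leq \dim_k H^1(G_1,\mathcal{T}_{\mathcal{O}}) \leq \sum_{i=1}^f \dim_k H^1\big(G_{t_i}/G_{t_{i-1}},\mathcal{T}_{\mathcal{O}}^{G_{t_{i-1}}}\big)^{G_{t_f}/G_{t_i}} \leq \sum_{i=1}^f \dim_k H^1\big(G_{t_i}/G_{t_{i-1}},\mathcal{T}_{\mathcal{O}}^{G_{t_{i-1}}}\big). \] The left bound is best possible in the sense that there are ramification filtrations such that the first inequality becomes an equality.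
   Context: $k$ is an algebraically closed field of characteristic $p\ge 5$; $L=k((t))$ has ring of integers $\mathcal{O}=k[[t]]$, and $G$ acts on $L$ by continuous $k$-automorphisms. $G_i=\{\sigma\in G: v_t(\sigma(t)-t)\ge i+1\}$ are the ramification groups in lower numbering. $\mathcal{T}_{\mathcal{O}}=k[[t]]\frac{d}{dt}$ is the module of $k$-derivations of $k[[t]]$, on which $\sigma\in G$ acts by conjugation: $\left(f(t)\frac{d}{dt}\right)^\sigma=\sigma(f(t))\,\sigma\!\left(\frac{d\sigma^{-1}(t)}{dt}\right)\frac{d}{dt}$. If $N\lhd \Gamma$ and $B$ is a $\Gamma$-module, $\Gamma/N$ acts on $H^1(N,B)$ by the conjugation action: the class of a cocycle $d$ is sent by $\sigma N$ to the class of $x\mapsto \sigma d(\sigma^{-1}x\sigma)$. The superscript $G_{t_f}/G_{t_i}$ denotes invariants for this action (with $\Gamma=G_{t_f}/G_{t_{i-1}}$, $N=G_{t_i}/G_{t_{i-1}}$, $B=\mathcal{T}_{\mathcal{O}}^{G_{t_{i-1}}}$). *)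

(* Defs.v *)
From HB Require Import structures.
From mathcomp Require Import all_boot all_order all_algebra all_fingroup.
From mathcomp Require Import boolp classical_sets constructive_ereal.

Set Implicit Arguments.
Unset Strict Implicit.
Unset Printing Implicit Defensive.

Import Order.TTheory GRing.Theory Num.Theory.

Local Open Scope ring_scope.

Record fps (k : Type) := FPS { fcoef : nat -> k }.

HB.instance Definition _ (k : Type) := gen_eqMixin (fps k).
HB.instance Definition _ (k : Type) := gen_choiceMixin (fps k).

Section PowerSeries.
Variable k : fieldType.
Implicit Types a b c : fps k.

Lemma fpsP a b : (forall n, fcoef a n = fcoef b n) -> a = b.
Proof. by case: a b => [a] [b] /= e; congr FPS; apply: funext. Qed.

Definition fps_zero : fps k := FPS (fun=> 0).
Definition fps_opp a : fps k := FPS (fun n => - fcoef a n).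
Definition fps_add a b : fps k := FPS (fun n => fcoef a n + fcoef b n).
Definition fps_one : fps k := FPS (fun n => (n == 0)%:R).
Definition fps_mul a b : fps k :=
  FPS (fun n => \sum_(j < n.+1) fcoef a j * fcoef b (n - j)%N).

Fact fps_addA : associative fps_add.
Proof. by move=> a b c; apply: fpsP => n /=; rewrite addrA. Qed.
Fact fps_addC : commutative fps_add.
Proof. by move=> a b; apply: fpsP => n /=; rewrite addrC. Qed.
Fact fps_add0 : left_id fps_zero fps_add.
Proof. by move=> a; apply: fpsP => n /=; rewrite add0r. Qed.
Fact fps_addN : left_inverse fps_zero fps_opp fps_add.
Proof. by move=> a; apply: fpsP => n /=; rewrite addNr. Qed.

HB.instance Definition _ :=
  GRing.isZmodule.Build (fps k) fps_addA fps_addC fps_add0 fps_addN.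

Lemma fcoef0 n : fcoef (0 : fps k) n = 0. Proof. by []. Qed.
Lemma fcoefD a b n : fcoef (a + b) n = fcoef a n + fcoef b n. Proof. by []. Qed.
Lemma fcoefN a n : fcoef (- a) n = - fcoef a n. Proof. by []. Qed.

Let trunc n a : {poly k} := \poly_(i < n.+1) fcoef a i.

Let mul_trunc m n a b : (n <= m)%N ->
  fcoef (fps_mul a b) n = (trunc m a * trunc m b)`_n.
Proof.
move=> le_nm; rewrite coefM /=; apply: eq_bigr => j _.
have le_jn : (j <= n)%N by rewrite -ltnS.
rewrite !coef_poly !ltnS (leq_trans le_jn le_nm).
by rewrite (leq_trans (leq_subr _ _) le_nm).
Qed.

Fact fps_mulC : commutative fps_mul.
Proof. by move=> a b; apply: fpsP => n; rewrite !(@mul_trunc n) // mulrC. Qed.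

Fact fps_mulA : associative fps_mul.
Proof.
move=> a b c; apply: fpsP => n.
transitivity ((trunc n a * (trunc n b * trunc n c))`_n).
  rewrite coefM /=; apply: eq_bigr => j _.
  rewrite -mul_trunc ?leq_subr // coef_poly ltnS.
  by rewrite (_ : (j <= n)%N) // -ltnS.
rewrite mulrA coefM /=; apply: eq_bigr => j _.
have le_jn : (j <= n)%N by rewrite -ltnS.
by rewrite -mul_trunc // coef_poly ltnS leq_subr.
Qed.

Fact fps_mul1 : left_id fps_one fps_mul.
Proof.
move=> a; apply: fpsP => n /=; rewrite big_ord_recl /= subn0 mul1r.
by rewrite big1 ?addr0 // => i _; rewrite mul0r.
Qed.

Fact fps_mulDl : left_distributive fps_mul fps_add.
Proof.
move=> a b c; apply: fpsP => n /=; rewrite -big_split /=.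
by apply: eq_bigr => j _; rewrite mulrDl.
Qed.

Fact fps_one_neq0 : fps_one != 0.
Proof.
by apply/eqP => /(congr1 (fun a => fcoef a 0)) /eqP; rewrite /= oner_eq0.
Qed.

HB.instance Definition _ := GRing.Zmodule_isComNzRing.Build (fps k)
  fps_mulA fps_mulC fps_mul1 fps_mulDl fps_one_neq0.

Lemma fcoef1 n : fcoef (1 : fps k) n = (n == 0)%:R. Proof. by []. Qed.
Lemma fcoefM a b n :
  fcoef (a * b) n = \sum_(j < n.+1) fcoef a j * fcoef b (n - j)%N.
Proof. by []. Qed.

Lemma fps_neq0 a : a != 0 -> exists n, fcoef a n != 0.
Proof.
move=> a0; apply: contrapT => none; move/eqP: a0; apply.
by apply: fpsP => n; apply/eqP/negPn/negP => an0; apply: none; exists n.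
Qed.

(** The order of vanishing at [t = 0]; the value at [0] is irrelevant. *)
Definition fps_ord a : nat :=
  if pselect (exists n, fcoef a n != 0) is left e then ex_minn e else 0.

Lemma fps_ordP a : a != 0 ->
  fcoef a (fps_ord a) != 0 /\ forall n, (n < fps_ord a)%N -> fcoef a n = 0.
Proof.
move=> /fps_neq0 an0; rewrite /fps_ord; case: pselect => // e.
case: ex_minnP => m am min; split=> // n lt_nm.
by apply/eqP; apply: contraLR lt_nm => /min; rewrite -leqNgt.
Qed.

Lemma fps_ord_eq a n : fcoef a n != 0 ->
  (forall m, (m < n)%N -> fcoef a m = 0) -> fps_ord a = n.
Proof.
move=> an lt_n.
have a0 : a != 0 by apply: contraNneq an => ->.
have [ao lt_o] := fps_ordP a0.
apply/eqP; rewrite eqn_leq; apply/andP; split; rewrite leqNgt; apply/negP.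
  by move/lt_o => e; rewrite e eqxx in an.
by move/lt_n => e; rewrite e eqxx in ao.
Qed.

Let ord_mulP a b : a != 0 -> b != 0 ->
  (fcoef (a * b) (fps_ord a + fps_ord b)%N =
     fcoef a (fps_ord a) * fcoef b (fps_ord b)) /\
  (forall n, (n < fps_ord a + fps_ord b)%N -> fcoef (a * b) n = 0).
Proof.
move=> /fps_ordP[_ mina] /fps_ordP[_ minb]; split.
  have lt_a : (fps_ord a < (fps_ord a + fps_ord b).+1)%N by rewrite ltnS leq_addr.
  rewrite fcoefM (bigD1 (Ordinal lt_a)) //= addKn big1 ?addr0 // => j ne_j.
  have [lt_j|le_j] := ltnP j (fps_ord a); first by rewrite mina ?mul0r.
  rewrite minb ?mulr0 // ltn_subLR; last by rewrite -ltnS.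
  rewrite ltn_add2r ltn_neqAle le_j andbT eq_sym.
  by apply: contra ne_j => /eqP e; apply/eqP/val_inj.
move=> n lt_n; rewrite fcoefM big1 // => j _.
have [lt_j|le_j] := ltnP j (fps_ord a); first by rewrite mina ?mul0r.
rewrite minb ?mulr0 // ltn_subLR; last by rewrite -ltnS.
by apply: leq_trans lt_n _; rewrite leq_add2r.
Qed.

Lemma fps_ordM a b : a != 0 -> b != 0 ->
  fps_ord (a * b) = (fps_ord a + fps_ord b)%N.
Proof.
move=> a0 b0; have [e lt_n] := ord_mulP a0 b0.
apply: fps_ord_eq lt_n; rewrite e mulf_neq0 //.
  by case: (fps_ordP a0).
by case: (fps_ordP b0).
Qed.

(** Units and inverses are obtained by classical choice. *)
Definition fps_unit a : bool := `[< exists b, b * a = 1 >].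
Definition fps_inv a : fps k := xget a [set b | b * a = 1].

Fact fps_mulV : {in fps_unit, left_inverse 1 fps_inv *%R}.
Proof.
move=> a /asboolP[b ba1]; rewrite /fps_inv.
by case: xgetP => [c -> //|/(_ b)].
Qed.
Fact fps_unitP a b : b * a = 1 -> fps_unit a.
Proof. by move=> e; apply/asboolP; exists b. Qed.
Fact fps_inv_out : {in [predC fps_unit], fps_inv =1 id}.
Proof.
move=> a /negP na; rewrite /fps_inv; case: xgetP => // b _ ba1.
by case: na; apply: fps_unitP ba1.
Qed.

HB.instance Definition _ := GRing.ComNzRing_hasMulInverse.Build (fps k)
  fps_mulV fps_unitP fps_inv_out.

Fact fps_mulf_eq0 a b : a * b = 0 -> (a == 0) || (b == 0).
Proof.
move=> ab0; apply/norP => -[a0 b0]; have [e _] := ord_mulP a0 b0.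
move: e; rewrite ab0 fcoef0 => /esym/eqP; rewrite mulf_eq0.
by rewrite (negPf (fps_ordP a0).1) (negPf (fps_ordP b0).1).
Qed.

HB.instance Definition _ :=
  GRing.ComUnitRing_isIntegral.Build (fps k) fps_mulf_eq0.

Definition fps_const (x : k) : fps k := FPS (fun n => x *+ (n == 0)).
Definition fps_var : fps k := FPS (fun n => (n == 1)%:R).
Definition fps_deriv a : fps k := FPS (fun n => fcoef a n.+1 *+ n.+1).

Fact fps_const_is_zmod_morphism : zmod_morphism fps_const.
Proof. by move=> x y; apply: fpsP => n /=; rewrite mulrnBl. Qed.
Fact fps_const_is_monoid_morphism : monoid_morphism fps_const.
Proof.
split=> [|x y]; apply: fpsP => n //=.
rewrite big_ord_recl /= subn0 big1 ?addr0 ?mulrnAr // => i _.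
by rewrite mulr0n mul0r.
Qed.
HB.instance Definition _ :=
  GRing.isZmodMorphism.Build k (fps k) fps_const fps_const_is_zmod_morphism.
HB.instance Definition _ :=
  GRing.isMonoidMorphism.Build k (fps k) fps_const fps_const_is_monoid_morphism.

Lemma fps_derivM a b :
  fps_deriv (a * b) = fps_deriv a * b + a * fps_deriv b.
Proof.
have Et m c i : (i <= m)%N -> fcoef (fps_deriv c) i = (trunc m.+1 c)^`()`_i.
  by move=> le_im; rewrite coef_deriv coef_poly !ltnS le_im.
apply: fpsP => n; rewrite -[LHS]/(fcoef (fps_mul a b) n.+1 *+ n.+1).
rewrite (@mul_trunc n.+1) // -coef_deriv derivM coefD.
rewrite fcoefD !coefM !fcoefM; congr (_ + _); apply: eq_bigr => j _.
  have le_jn : (j <= n)%N by rewrite -ltnS.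
  rewrite (Et n) //; congr (_ * _).
  by rewrite coef_poly ltnS (leq_trans (leq_subr _ _)).
rewrite (Et n) ?leq_subr //; congr (_ * _).
by rewrite coef_poly ltnS (ltnW (ltn_ord j)).
Qed.

End PowerSeries.

(** [k((t))] is built as the fraction field of [k[[t]]]. *)

Definition laurent (k : fieldType) : Type := {fraction fps k}.

Section Laurent.
Variable k : fieldType.
Local Notation L := (laurent k).

HB.instance Definition _ := GRing.Field.on L.

Definition of_fps (a : fps k) : L := FracField.tofrac a.
HB.instance Definition _ := GRing.RMorphism.copy of_fps (@FracField.tofrac (fps k)).

Definition laurent_scale (c : k) (x : L) : L := of_fps (fps_const c) * x.

Fact laurent_scaleA a b x :
  laurent_scale a (laurent_scale b x) = laurent_scale (a * b) x.
Proof. by rewrite /laurent_scale mulrA -!rmorphM. Qed.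
Fact laurent_scale1 : left_id 1 laurent_scale.
Proof. by move=> x; rewrite /laurent_scale !rmorph1 mul1r. Qed.
Fact laurent_scaleDr : right_distributive laurent_scale +%R.
Proof. by move=> c x y; rewrite /laurent_scale mulrDr. Qed.
Fact laurent_scaleDl x : {morph laurent_scale^~ x : a b / a + b}.
Proof. by move=> a b; rewrite /laurent_scale !rmorphD mulrDl. Qed.
HB.instance Definition _ := GRing.Zmodule_isLmodule.Build k L
  laurent_scaleA laurent_scale1 laurent_scaleDr laurent_scaleDl.

Fact laurent_scaleAl (c : k) (x y : L) : c *: (x * y) = (c *: x) * y.
Proof. exact: mulrA. Qed.
HB.instance Definition _ := GRing.Lmodule_isLalgebra.Build k L laurent_scaleAl.
Fact laurent_scaleAr (c : k) (x y : L) : c *: (x * y) = x * (c *: y).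
Proof. by rewrite mulrC laurent_scaleAl mulrC. Qed.
HB.instance Definition _ := GRing.Lalgebra_isAlgebra.Build k L laurent_scaleAr.

Definition tvar : L := of_fps (fps_var k).

Local Notation qrepr := (@generic_quotient.repr _ {fraction fps k}).
Local Notation qpi := (@generic_quotient.pi _ {fraction fps k}).

Definition num (x : L) : fps k := \n_(qrepr x).
Definition den (x : L) : fps k := \d_(qrepr x).

Lemma den_neq0 x : den x != 0. Proof. exact: denom_ratioP. Qed.

Lemma of_fps_inj : injective of_fps.
Proof. by move=> a b /eqP; rewrite /of_fps tofrac_eq => /eqP. Qed.

Lemma of_fps_eq0 a : (of_fps a == 0) = (a == 0).
Proof. exact: tofrac_eq0. Qed.

Let repr_mul_den (x : {fraction fps k}) :
  x * FracField.tofrac \d_(qrepr x) = FracField.tofrac \n_(qrepr x).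
Proof.
have {1}<- : qpi (qrepr x) = x by exact: generic_quotient.reprK.
move: (qrepr x) => r; unlock FracField.tofrac; rewrite -[LHS]FracField.pi_mul.
apply/eqP; rewrite FracField.equivf_def /FracField.mulf.
by rewrite !numden_Ratio ?mulf_neq0 ?oner_eq0 ?denom_ratioP // !mulr1 mulrC.
Qed.

Lemma num_den (x : L) : x = of_fps (num x) / of_fps (den x).
Proof.
have d0 : of_fps (den x) != 0 by rewrite of_fps_eq0 den_neq0.
apply: (mulIf d0); rewrite mulfVK //; exact: repr_mul_den.
Qed.

(** The valuation is computed on a chosen fraction; [val_t_frac] below shows
    that it does not depend on that choice. *)
Definition val_t (x : L) : \bar int :=
  if x == 0 then +oo%E else ((fps_ord (num x))%:Z - (fps_ord (den x))%:Z)%:E.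

Arguments val_t x%_R.

(** The quotient rule on a chosen fraction; only the values on [k[[t]]], given by
    [ddt_of_fps], matter below. *)
Definition ddt (x : L) : L :=
  of_fps (fps_deriv (num x) * den x - num x * fps_deriv (den x)) /
  of_fps (den x) ^+ 2.

Lemma val_t_frac a b : a != 0 -> b != 0 ->
  val_t (of_fps a / of_fps b) = ((fps_ord a)%:Z - (fps_ord b)%:Z)%:E.
Proof.
move=> a0 b0; set x := _ / _.
have x0 : x != 0 by rewrite mulf_neq0 ?invr_eq0 ?of_fps_eq0.
have e : num x * b = a * den x.
  have: x == of_fps (num x) / of_fps (den x) by rewrite -num_den.
  rewrite /x eqr_div ?of_fps_eq0 ?den_neq0 // -!rmorphM.
  by move/eqP/of_fps_inj.
have n0 : num x != 0.
  by apply: contraNneq (mulf_neq0 a0 (den_neq0 x)) => nx0; rewrite -e nx0 mul0r.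
move: (congr1 (@fps_ord k) e); rewrite !fps_ordM ?den_neq0 // => e'.
rewrite /val_t (negPf x0); congr (_%:E); apply/eqP.
by rewrite subr_eq addrAC eq_sym subr_eq -!PoszD -e'.
Qed.

Lemma ddt_of_fps a : ddt (of_fps a) = of_fps (fps_deriv a).
Proof.
set x := of_fps a; set n := num x; set d := den x.
have d0 : of_fps d != 0 by rewrite of_fps_eq0 den_neq0.
have e : n = a * d.
  have ex : x * of_fps d = of_fps n by rewrite [X in X * _]num_den mulfVK.
  by apply: of_fps_inj; rewrite rmorphM; exact: esym ex.
rewrite /ddt -/n -/d e fps_derivM.
apply: (mulIf (expf_neq0 2 d0)); rewrite mulfVK ?expf_neq0 //.
rewrite -rmorphXn -rmorphM; congr of_fps.
by rewrite mulrDl [a * fps_deriv d * d]mulrAC addrK expr2 mulrA.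
Qed.

Definition continuous_t (s : L -> L) : Prop :=
  forall (x : L) (n : int), exists m : int, forall y : L,
    (m%:E <= val_t (y - x))%E -> (n%:E <= val_t (s y - s x))%E.

Definition cauchy_t (u : nat -> L) : Prop :=
  forall n : int, exists N : nat, forall i j : nat,
    (N <= i)%N -> (N <= j)%N -> (n%:E <= val_t (u i - u j))%E.

Definition converges_t (u : nat -> L) (l : L) : Prop :=
  forall n : int, exists N : nat, forall i : nat,
    (N <= i)%N -> (n%:E <= val_t (u i - l))%E.

(** [K] is a subfield of [L] on which [v_t] is nontrivial (it is discrete, being
    integer-valued) and complete. *)
Record local_subfield (K : {pred L}) : Prop := LocalSubfield {
  local_subfield_closed : divring_closed K;
  local_subfield_nontrivial : exists2 x, x \in K & x != 0 /\ val_t x != 0%E;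
  local_subfield_complete : forall u : nat -> L, (forall i, u i \in K) ->
    cauchy_t u -> exists2 l, l \in K & converges_t u l
}.

(** The finite group [gT], acting through [rho] by continuous [k]-automorphisms,
    is the Galois group of [L/K]. *)
Record galois_group (gT : finGroupType) (rho : gT -> {lrmorphism L -> L})
    (K : {pred L}) : Prop := GaloisGroup {
  galois_act1 : forall x, rho 1%g x = x;
  galois_actM : forall g h x, rho (g * h)%g x = rho g (rho h x);
  galois_faithful : forall g h, rho g =1 rho h -> g = h;
  galois_continuous : forall g, continuous_t (rho g);
  galois_fixed : forall x, x \in K <-> (forall g, rho g x = x);
  galois_full : forall s : {rmorphism L -> L}, bijective s ->
    {in K, forall x, s x = x} -> exists g, s =1 rho g
}.

End Laurent.

Arguments val_t {k} x%_R.

Section Dimension.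
Variables (k : fieldType) (V : lmodType k).

(** For a subspace [B] of a subspace [Z], there is a family of [n] vectors of
    [Z] whose classes form a [k]-basis of [Z / B]. *)
Definition quot_has_dim (Z B : set V) (n : nat) : Prop :=
  exists v : 'I_n -> V,
    [/\ forall i, Z (v i),
        forall z, Z z -> exists c : 'I_n -> k, B (z - \sum_(i < n) c i *: v i)
      & forall c : 'I_n -> k, B (\sum_(i < n) c i *: v i) -> forall i, c i = 0].

(** [dim_k (Z / B)], a natural number or [+oo]. *)
Definition quot_dim (Z B : set V) : \bar int :=
  if pselect (exists n, quot_has_dim Z B n) is left e
  then ((projT1 (cid e))%:Z)%:E else +oo%E.

End Dimension.

Section Cohomology.
Variables (k : fieldType) (V : lmodType k) (rT : finGroupType).
Variable act : rT -> V -> V.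
Variables (N : {set rT}) (B : set V).

(** Cochains on [N] are functions on [rT] that vanish outside [N]. *)
Definition cochain : set {ffun rT -> V} := fun d =>
  (forall x, x \in N -> B (d x)) /\ (forall x, x \notin N -> d x = 0).

Definition cocycle : set {ffun rT -> V} := fun d =>
  cochain d /\ {in N &, forall x y, d (x * y)%g = d x + act x (d y)}.

Definition coboundary : set {ffun rT -> V} := fun d =>
  cochain d /\ exists2 b, B b & {in N, forall x, d x = act x b - b}.

Definition dim_H1 : \bar int := quot_dim cocycle coboundary.

(** [x ^ s] is [s^-1 * x * s]. *)
Definition conj_cochain (s : rT) (d : {ffun rT -> V}) : {ffun rT -> V} :=
  [ffun x => act s (d (x ^ s)%g)].

(** [N] normal in [Gam]: the cocycles whose class in [H^1(N, B)] is fixed by the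
    conjugation action of [Gam / N]. *)
Definition invariant_cocycle (Gam : {set rT}) : set {ffun rT -> V} := fun d =>
  cocycle d /\
  {in Gam, forall s, coboundary (conj_cochain s d - d)}.

Definition dim_H1_inv (Gam : {set rT}) : \bar int :=
  quot_dim (invariant_cocycle Gam) coboundary.

End Cohomology.

Section Ramification.
Variables (k : fieldType) (gT : finGroupType).
Local Notation L := (laurent k).
Variable rho : gT -> {lrmorphism L -> L}.

Definition ram (i : nat) : {set gT} :=
  [set g | ((i.+1%:Z)%:E <= val_t (rho g (tvar k) - tvar k))%E].

(** The derivation [f d/dt] is represented by its coefficient [f]; those of
    [T_O] are the [f] in [k[[t]]]. *)
Definition TO : set L := range (@of_fps k).

(** The coefficient of the conjugate derivation [rho s \o f d/dt \o
    rho s^-1]. *)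
Definition derivation_act (s : gT) (f : L) : L :=
  rho s f * rho s (ddt (rho s^-1%g (tvar k))).

Definition TO_fixed (H : {set gT}) : set L := fun f =>
  TO f /\ {in H, forall s, derivation_act s f = f}.

(** A coset of [H] acts on the [H]-invariants through any representative. *)
Definition coset_act (H : {set gT}) (x : coset_of H) (f : L) : L :=
  derivation_act (repr x) f.

Definition dim_H1_TO : \bar int := dim_H1 derivation_act (ram 1) TO.

Definition dim_H1_quot (A H : {set gT}) : \bar int :=
  dim_H1 (@coset_act H) (A / H)%g (TO_fixed H).

(** [dim_k H^1(A / H, T_O^H)^(Gam / A)], where [Gam / A] is read as
    [(Gam / H) / (A / H)] *)
Definition dim_H1_quot_inv (Gam A H : {set gT}) : \bar int :=
  dim_H1_inv (@coset_act H) (A / H)%g (TO_fixed H) (Gam / H)%g.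

(** [t 1 > ... > t f] are the jumps of the ramification filtration of [G_1]; in
    particular [G_1] is nontrivial. The index [t 0 = t 1 + 1] encodes the convention
    that [G_(t 0)] is trivial. *)
Record jump_sequence (f : nat) (t : nat -> nat) : Prop := JumpSequence {
  jump_count : (1 <= f)%N;
  jump_last_pos : (1 <= t f)%N;
  jump_first_block : forall i, (1 <= i <= t f)%N -> ram i = ram 1;
  jump_decreasing : forall l, (1 <= l < f)%N -> (t l.+1 < t l)%N;
  jump_block : forall l, (1 <= l < f)%N ->
    forall i, (t l.+1 < i <= t l)%N -> ram i = ram (t l);
  jump_strict : forall l, (1 <= l <= f)%N -> ram (t l).+1 \proper ram (t l);
  jump_zero : t 0 = (t 1).+1;
  jump_end : ram (t 0) = [set 1%g]
}.

End Ramification.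

(* Main.v *)
From HB Require Import structures.
Require Import Defs.
From mathcomp Require Import all_boot all_order all_algebra all_fingroup.
From mathcomp Require Import boolp classical_sets constructive_ereal.
From mathcomp Require Import zify ring.

Set Implicit Arguments.
Unset Strict Implicit.
Unset Printing Implicit Defensive.

Import Order.TTheory GRing.Theory Num.Theory.

Local Open Scope ring_scope.

(** The inequalities come from the inflation-restriction sequence
    [0 -> H^1(Gam/A, M^A) -> H^1(Gam/H, M^H) -> H^1(A/H, M^H)^(Gam/A)], applied
    with [Gam = G_1] to consecutive terms [H <= A] of the filtration. Inflation
    from [G_1 / G_(t_(f-1))] gives the left bound. Restriction, iterated from the
    trivial subgroup up to [A = Gam], where the first term vanishes, gives the
    middle one. That [T_O] is a [G]-module is the chain rule for continuous
    automorphisms of [k((t))].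

    The left bound is attained as soon as there is a single jump, for instance by
    [Z/p] acting through [t |-> t / (1 - c t)] for [c] in the prime field. *)

(** * Dimensions of quotients *)

(** No finiteness is known in advance, so every bound compares values of [quot_dim] in the naturals
    with [+oo]. A bound is immediate when its right side is infinite; otherwise it is a count of
    families free modulo coboundaries, carried along linear maps of cochains.

    Continuity is only given in its epsilon-delta form on [k((t))]. The point to extract from it is
    that an automorphism maps [t^n k[[t]]] into itself; identities in [k[[t]]] are then proved
    modulo every [t^n], by splitting off constant terms.

    In the coordinate [1 / t] the example is the translation to [1 / t - c], so these automorphisms
    form a copy of the additive group. A nontrivial one moves [t] by a series of order exactly 2,
    which puts the only jump at 1. What remains is to see that the fixed field is complete with this
    Galois group; since [galois_full] ranges over all field automorphisms over it, continuous or
    not, this calls for an algebraic argument. *)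

Section Subspaces.
Variables (k : fieldType) (V : lmodType k).

Definition subspace (Z : set V) : Prop :=
  Z 0 /\ forall (c : k) x y, Z x -> Z y -> Z (c *: x + y).

Section Closure.
Variable Z : set V.
Hypothesis subZ : subspace Z.

Lemma subspace0 : Z 0. Proof. by case: subZ. Qed.
Lemma subspaceD x y : Z x -> Z y -> Z (x + y).
Proof. by case: subZ => _ ZP Zx Zy; rewrite -[x]scale1r; apply: ZP. Qed.
Lemma subspaceZ c x : Z x -> Z (c *: x).
Proof. by case: subZ => Z0 ZP Zx; rewrite -[_ *: _]addr0; apply: ZP. Qed.
Lemma subspaceN x : Z x -> Z (- x).
Proof. by rewrite -scaleN1r; apply: subspaceZ. Qed.
Lemma subspaceB x y : Z x -> Z y -> Z (x - y).
Proof. by move=> Zx /subspaceN; apply: subspaceD. Qed.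
Lemma subspace_lincomb (I : finType) (c : I -> k) (v : I -> V) :
  (forall i, Z (v i)) -> Z (\sum_i c i *: v i).
Proof.
move=> Zv; apply: (big_ind Z) => [||i _]; first exact: subspace0.
  exact: subspaceD.
exact: subspaceZ.
Qed.
End Closure.

Definition free_mod (Z B : set V) (m : nat) (v : 'I_m -> V) : Prop :=
  (forall i, Z (v i)) /\
  forall c : 'I_m -> k, B (\sum_i c i *: v i) -> forall i, c i = 0.

Section QuotDim.
Variables Z B : set V.
Hypotheses (subB : subspace B).

Lemma quot_has_dim_free n :
  quot_has_dim Z B n -> exists v : 'I_n -> V, free_mod Z B v.
Proof. by case=> v [Zv _ fv]; exists v. Qed.

(** Writing the classes of the [v i] in a basis of [Z / B] gives the rows of [M], so that
    [u *m M = 0] makes [u] a relation between the [v i] modulo [B]. *)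
Lemma quot_has_dim_coord n m (v : 'I_m -> V) :
  quot_has_dim Z B n -> (forall i, Z (v i)) ->
  exists w : 'I_n -> V, exists M : 'M[k]_(m, n),
    forall u : 'rV_m, B (\sum_i u 0 i *: v i - \sum_j (u *m M) 0 j *: w j).
Proof.
case=> w [_ spanw _] Zv.
have /cid[c cP] : exists c : 'I_m -> 'I_n -> k,
    forall i, B (v i - \sum_j c i j *: w j).
  exists (fun i => projT1 (cid (spanw _ (Zv i)))) => i.
  by case: (cid _).
exists w, (\matrix_(i, j) c i j) => u.
have -> : \sum_j (u *m (\matrix_(i, j) c i j)) 0 j *: w j =
    \sum_i u 0 i *: \sum_j c i j *: w j.
  under eq_bigr do rewrite mxE scaler_suml.
  rewrite exchange_big /=; apply: eq_bigr => i _; rewrite scaler_sumr.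
  by apply: eq_bigr => j _; rewrite mxE scalerA.
rewrite -sumrB; under eq_bigr do rewrite -scalerBr.
exact: subspace_lincomb.
Qed.

Lemma free_mod_leq n m (v : 'I_m -> V) :
  quot_has_dim Z B n -> free_mod Z B v -> (m <= n)%N.
Proof.
move=> dimn [Zv fv]; have [w [M MP]] := quot_has_dim_coord dimn Zv.
suff /eqP <- : row_free M by exact: rank_leq_col.
apply: inj_row_free => u uM0; have := MP u.
rewrite uM0 [X in _ - X]big1 ?subr0 => [/fv u0|j _]; last by rewrite mxE scale0r.
by apply/rowP => i; rewrite u0 mxE.
Qed.

Lemma quot_dimE n : quot_has_dim Z B n -> quot_dim Z B = (n%:Z)%:E.
Proof.
move=> dimn; rewrite /quot_dim; case: pselect => [e|]; last by case; exists n.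
case: (cid e) => m /= dimm; congr (_%:Z%:E); apply/eqP; rewrite eqn_leq.
have [v fv] := quot_has_dim_free dimn; have [w fw] := quot_has_dim_free dimm.
by rewrite (free_mod_leq dimn fw) (free_mod_leq dimm fv).
Qed.

Lemma quot_dim_cases :
  (exists2 n, quot_has_dim Z B n & quot_dim Z B = (n%:Z)%:E) \/
  quot_dim Z B = +oo%E.
Proof.
rewrite /quot_dim; case: pselect => [e|]; last by right.
by left; case: (cid e) => m /= dimm; exists m.
Qed.

Lemma quot_dim_ge0 : (0 <= quot_dim Z B)%E.
Proof. by have [[n _ ->]|->] := quot_dim_cases. Qed.

(* A free family of maximal size spans modulo [B]. *)
Lemma quot_dim_le N : (forall m (v : 'I_m -> V), free_mod Z B v -> (m <= N)%N) ->
  (quot_dim Z B <= (N%:Z)%:E)%E.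
Proof.
move=> bound.
have ex0 : exists m, `[< exists v : 'I_m -> V, free_mod Z B v >].
  by exists 0; apply/asboolP; exists (fun=> 0); split=> [[]//|c _ []].
have ub m : `[< exists v : 'I_m -> V, free_mod Z B v >] -> (m <= N)%N.
  by move=> /asboolP[v]; apply: bound.
case: (ex_maxnP ex0 ub) => n /asboolP[v [Zv fv]] maxn.
suff dimn : quot_has_dim Z B n.
  rewrite (quot_dimE dimn) lee_fin lez_nat; apply: bound; split; first exact: Zv.
  exact: fv.
exists v; split=> // z Zz.
pose w (i : 'I_n.+1) := if unlift ord0 i is Some j then v j else z.
have nfw : ~ free_mod Z B w.
  move=> fw; suff /maxn : `[< exists v : 'I_n.+1 -> V, free_mod Z B v >].
    by rewrite ltnn.
  by apply/asboolP; exists w.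
have Zw i : Z (w i) by rewrite /w; case: unliftP.
have /existsNP[c /not_implyP[Bc /existsNP[i /eqP ci]]] :
  ~ forall c, B (\sum_i c i *: w i) -> forall i, c i = 0 by move=> h; apply: nfw.
have sumw : \sum_i c i *: w i = c ord0 *: z + \sum_j c (lift ord0 j) *: v j.
  rewrite big_ord_recl {1}/w unlift_none; congr (_ + _).
  by apply: eq_bigr => j _; rewrite /w liftK.
rewrite sumw in Bc.
have c0 : c ord0 != 0.
  apply: contraNneq ci => c0; case: (unliftP ord0 i) => [j|] ->; last by rewrite c0.
  by apply/eqP; move: Bc; rewrite c0 scale0r add0r => /(fv (fun j => c _)).
exists (fun j => - (c ord0)^-1 * c (lift ord0 j)).
have := subspaceZ subB (c ord0)^-1 Bc.
rewrite scalerDr scalerA mulVf // scale1r scaler_sumr; congr (B (_ + _)).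
by rewrite -sumrN; apply: eq_bigr => j _; rewrite -scaleNr mulNr opprK scalerA.
Qed.

End QuotDim.
End Subspaces.

Section QuotDimMap.
Variables (k : fieldType) (V W : lmodType k) (phi : {linear V -> W}).
Variables (Z B : set V) (Z2 B2 : set W).
Hypotheses (subZ : subspace Z) (subB : subspace B) (subB2 : subspace B2).
Hypothesis phiZ : forall z, Z z -> Z2 (phi z).

Lemma le_quot_dim : (forall z, Z z -> B2 (phi z) -> B z) ->
  (quot_dim Z B <= quot_dim Z2 B2)%E.
Proof.
move=> phiB; have [[n dimn ->]|->] := quot_dim_cases Z2 B2; last exact: leey.
apply: quot_dim_le => // m v [Zv fv].
apply: (free_mod_leq (v := phi \o v) subB2 dimn); split=> [i|c /= Bc].
  exact/phiZ/Zv.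
apply: fv; apply: phiB; first exact: subspace_lincomb.
by rewrite linear_sum; under eq_bigr do rewrite linearZ.
Qed.

(** Rank-nullity: for a free family of size [m], let [M] be the matrix of its images modulo [B2].
    Its rank is at most [n2]; its left kernel gives combinations that [ker] moves into [Z1], where
    they remain free modulo [B1], so its nullity is at most [n1]. *)
Lemma quot_dim_exact (Z1 B1 : set V) (subB1 : subspace B1) :
  (forall z, Z z -> B2 (phi z) -> exists2 z1, Z1 z1 & B (z - z1)) ->
  (forall z, B1 z -> B z) ->
  (quot_dim Z B <= quot_dim Z1 B1 + quot_dim Z2 B2)%E.
Proof.
move=> ker B1B; have [[n2 dim2 ->]|->] := quot_dim_cases Z2 B2; last first.
  by rewrite addey ?leey // gt_eqF // (lt_le_trans _ (quot_dim_ge0 _ _)).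
have [[n1 dim1 ->]|->] := quot_dim_cases Z1 B1; last by rewrite leey.
rewrite -EFinD -PoszD; apply: quot_dim_le => // m v [Zv fv].
have [w [M MP]] := quot_has_dim_coord (v := phi \o v) subB2 dim2
  (fun i => phiZ (Zv i)).
pose U := row_base (kermx M).
have UM0 : U *m M = 0 by apply/sub_kermxP; rewrite eq_row_base.
pose z l := \sum_i U l i *: v i.
have Zz l : Z (z l) by apply: subspace_lincomb.
have Bz l : B2 (phi (z l)).
  have := MP (row l U); rewrite -row_mul UM0 [X in _ - X]big1 ?subr0.
    by rewrite linear_sum; under eq_bigr do rewrite mxE /= -linearZ.
  by move=> j _; rewrite !mxE scale0r.
have /cid[z1 z1P] : exists z1, forall l, Z1 (z1 l) /\ B (z l - z1 l).
  exists (fun l => s2val (cid2 (ker _ (Zz l) (Bz l)))) => l.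
  by case: (cid2 _).
have : (\rank (kermx M) <= n1)%N.
  apply: (free_mod_leq (v := z1) subB1 dim1); split=> [l|c /B1B Bc].
    by case: (z1P l).
  have Bcz : B (\sum_l c l *: z l).
    have /(subspaceD subB Bc) :
        B (\sum_l c l *: (z l - z1 l)).
      by apply: subspace_lincomb => // l; case: (z1P l).
    rewrite -big_split /=; congr B; apply: eq_bigr => l _.
    by rewrite -scalerDr addrC subrK.
  have : B (\sum_i ((\row_l c l) *m U) 0 i *: v i).
    move: Bcz; congr B; under [RHS]eq_bigr do rewrite mxE scaler_suml.
    rewrite exchange_big /=; apply: eq_bigr => l _; rewrite /z scaler_sumr.
    by apply: eq_bigr => i _; rewrite scalerA mxE.
  move=> /fv cU0 l.
  (* The rows of [U] are independent: a right inverse turns [c *m U = 0] into [c = 0]. *)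
  have /row_freeP[U' UU'] := row_base_free (kermx M).
  have /(congr1 (mulmxr U')) : (\row_l c l) *m U = 0.
    by apply/rowP => i; rewrite cU0 mxE.
  by rewrite /= -mulmxA UU' mulmx1 mul0mx => /rowP/(_ l); rewrite !mxE.
rewrite mxrank_ker leq_subLR => /leq_trans; apply; rewrite addnC leq_add2l.
exact: rank_leq_col.
Qed.

End QuotDimMap.

Lemma quot_dim0 (k : fieldType) (V : lmodType k) (Z B : set V) :
  subspace B -> (forall z, Z z -> B z) -> quot_dim Z B = 0%E.
Proof.
move=> subB ZB; apply: (@quot_dimE _ _ _ _ subB 0); exists (fun=> 0).
split=> [[]//|z /ZB Bz|c _ []//].
by exists (fun=> 0); rewrite big_ord0 subr0.
Qed.

(** * Inflation and restriction *)

Section CochainSpaces.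
Variables (k : fieldType) (V : lmodType k) (rT : finGroupType).
Variable act : rT -> V -> V.
Hypothesis act_lin : forall g, linear (act g).
Variables (N : {set rT}) (B : set V).
Hypothesis subB : subspace B.

Lemma lin_act0 g : act g 0 = 0.
Proof.
have /eqP := act_lin g 1 0 0; rewrite !scale1r addr0.
by rewrite -subr_eq0 opprD addrA subrr sub0r oppr_eq0 => /eqP.
Qed.

Lemma lin_actB g x y : act g (x - y) = act g x - act g y.
Proof. by rewrite addrC -scaleN1r act_lin scaleN1r addrC. Qed.

Lemma subspace_cochain : subspace (cochain N B).
Proof.
split=> [|c d e [Bd d0] [Be e0]].
  by split=> x _; rewrite ffunE //; apply: subspace0.
split=> x Nx; rewrite !ffunE; first by apply: subB.2; [apply: Bd|apply: Be].
by rewrite d0 // e0 // scaler0 addr0.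
Qed.

Lemma subspace_cocycle : subspace (cocycle act N B).
Proof.
split=> [|c d e [Zd dM] [Ze eM]].
  split=> [|x y Nx Ny]; first exact: subspace0 subspace_cochain.
  by rewrite !ffunE lin_act0 addr0.
split=> [|x y Nx Ny]; first by apply: subspace_cochain.2.
by rewrite !ffunE dM // eM // act_lin scalerDr addrACA.
Qed.

Lemma subspace_coboundary : subspace (coboundary act N B).
Proof.
split=> [|c d e [Zd [b Bb db]] [Ze [b' Bb' eb']]].
  split; first exact: subspace0 subspace_cochain.
  exists 0 => [|x Nx]; first exact: subspace0 subB.
  by rewrite ffunE lin_act0 subr0.
split; first by apply: subspace_cochain.2.
exists (c *: b + b') => [|x Nx]; first exact: subB.2.
by rewrite !ffunE db // eb' // act_lin scalerBr opprD addrACA.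
Qed.

Lemma conj_cochainP s c d e :
  conj_cochain act s (c *: d + e) =
    c *: conj_cochain act s d + conj_cochain act s e.
Proof. by apply/ffunP => x; rewrite !ffunE act_lin. Qed.

Lemma dim_H1_inv_le (Gam : {set rT}) :
  (dim_H1_inv act N B Gam <= dim_H1 act N B)%E.
Proof.
have subBd := subspace_coboundary.
apply: (@le_quot_dim _ _ _ idfun) => // [|d []//].
split=> [|c d e [Zd dI] [Ze eI]].
  split=> [|s _]; first exact: subspace0 subspace_cocycle.
  rewrite (_ : _ - _ = 0); first exact: subspace0 subBd.
  by apply/ffunP => x; rewrite !ffunE lin_act0 subr0.
split=> [|s Gs]; first by apply: subspace_cocycle.2.
rewrite conj_cochainP opprD addrACA -scalerBr.
by apply: subBd.2; [apply: dI|apply: eI].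
Qed.

End CochainSpaces.

Section Pullback.
Variables (k : fieldType) (V : lmodType k) (S T : finType).
Variables (h : S -> T) (P : {set S}).

(** The support [P] is there because [cochain] demands the value 0 outside the group. With
    [h := coset H] this is inflation; with [h := repr] it passes back to cosets; with [h := id] it
    only erases the values outside [P]. *)
Definition pullback (d : {ffun T -> V}) : {ffun S -> V} :=
  [ffun x => if x \in P then d (h x) else 0].

Fact pullback_is_linear : linear pullback.
Proof.
move=> c d e; apply/ffunP => x; rewrite !ffunE; case: ifP => // _.
by rewrite scaler0 addr0.
Qed.

HB.instance Definition _ :=
  GRing.isLinear.Build k {ffun T -> V} {ffun S -> V} _ pullback
    pullback_is_linear.
End Pullback.

Section InflationRestriction.
Local Open Scope group_scope.
Local Open Scope ring_scope.
Variables (k : fieldType) (V : lmodType k) (gT : finGroupType).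
Variable act : gT -> V -> V.
Hypothesis act_lin : forall g, linear (act g).
Hypothesis act1 : forall v, act 1%g v = v.
Hypothesis actM : forall g h v, act (g * h)%g v = act g (act h v).
Variable M : set V.
Hypothesis subM : subspace M.
Hypothesis stabM : forall g v, M v -> M (act g v).

(** Together with [cact], the abstract form of [TO_fixed] and [coset_act]: for
    [act := derivation_act rho] and [M := @TO k] they unfold to these, so the results below apply by
    conversion. *)
Definition fixed (H : {set gT}) : set V := fun v =>
  M v /\ {in H, forall s, act s v = v}.

Definition cact (H : {set gT}) (x : coset_of H) (v : V) : V := act (repr x) v.

Lemma cact_lin H x : linear (@cact H x).
Proof. exact: act_lin. Qed.

Lemma subspace_fixed H : subspace (fixed H).
Proof.
split=> [|c x y [Mx fx] [My fy]].
  by split=> [|s _]; [exact: subspace0 subM | rewrite (lin_act0 act_lin)].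
split=> [|s Hs]; first exact: subM.2.
by rewrite act_lin fx // fy.
Qed.

Lemma fixed_norm (H : {group gT}) x v :
  x \in 'N(H) -> fixed H v -> fixed H (act x v).
Proof.
move=> Nx [Mv fv]; split=> [|s Hs]; first exact: stabM.
by rewrite -actM conjgC actM fv // memJ_norm.
Qed.

Lemma repr_cosetP (H : {group gT}) x : x \in 'N(H) ->
  exists2 h, h \in H & repr (coset H x) = (h * x)%g.
Proof.
by move=> Nx; apply/rcosetP; rewrite -val_coset //; apply: mem_repr_coset.
Qed.

Lemma act_repr (H : {group gT}) x v :
  x \in 'N(H) -> fixed H v -> act (repr (coset H x)) v = act x v.
Proof.
move=> Nx fv; have [h Hh ->] := repr_cosetP Nx.
by rewrite actM (fixed_norm Nx fv).2.
Qed.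

(* Cocycles on [A] vanishing on [H] are the inflations of the cocycles on
   [A / H]; working with them avoids coset representatives. Their values outside
   [A] are left arbitrary. *)
Definition rel_cocycle (H A : {set gT}) : set {ffun gT -> V} := fun d =>
  [/\ {in A, forall x, M (d x)},
      {in A &, forall x y, d (x * y)%g = d x + act x (d y)}
    & {in H, forall h, d h = 0}].

Definition rel_coboundary (H A : {set gT}) : set {ffun gT -> V} := fun d =>
  exists2 b, fixed H b & {in A, forall x, d x = act x b - b}.

Lemma subspace_rel_cocycle H A : subspace (rel_cocycle H A).
Proof.
split=> [|c d e [Md dM d0] [Me eM e0]].
  by split=> [x|x y|x] *; rewrite !ffunE ?(lin_act0 act_lin) ?addr0 //;
    apply: subspace0.
split=> [x Ax|x y Ax Ay|h Hh]; rewrite !ffunE.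
- by apply: subM.2; [apply: Md|apply: Me].
- by rewrite dM // eM // act_lin scalerDr addrACA.
- by rewrite d0 // e0 // scaler0 addr0.
Qed.

Lemma subspace_rel_coboundary H A : subspace (rel_coboundary H A).
Proof.
split=> [|c d e [b fb db] [b' fb' eb']].
  exists 0 => [|x Ax]; first exact: subspace0 (subspace_fixed H).
  by rewrite ffunE (lin_act0 act_lin) // subr0.
exists (c *: b + b') => [|x Ax]; first exact: (subspace_fixed H).2.
by rewrite !ffunE db // eb' // act_lin scalerBr opprD addrACA.
Qed.

Definition dim_rel_H1 (H A : {set gT}) : \bar int :=
  quot_dim (rel_cocycle H A) (rel_coboundary H A).

Section Quotient.
Variables (H A : {group gT}).
Hypothesis nHA : H <| A.

Let nA : {subset A <= 'N(H)}.
Proof. exact: fintype.subsetP (normal_norm nHA). Qed.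
Let HA : {subset H <= A}.
Proof. exact: fintype.subsetP (normal_sub nHA). Qed.

Lemma mem_repr_quotient (y : coset_of H) : y \in (A / H)%g -> repr y \in A.
Proof.
move=> /morphimP[x Nx Ax ->]; have [h Hh ->] := repr_cosetP Nx.
by rewrite groupM // HA.
Qed.

(** Since [h * x = x * h ^ x] and [d] vanishes at [h ^ x], the cocycle relation leaves [d x]. Thus
    [d] depends only on the coset. *)
Lemma rel_cocycle_mull d h x :
  rel_cocycle H A d -> h \in H -> x \in A -> d (h * x)%g = d x.
Proof.
move=> [_ dM d0] Hh Ax; have Nx := nA Ax.
have Hhx : (h ^ x)%g \in H by rewrite memJ_norm.
by rewrite conjgC dM ?(HA Hhx) // (d0 _ Hhx) (lin_act0 act_lin) addr0.
Qed.

Lemma rel_cocycle_repr d x :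
  rel_cocycle H A d -> x \in A -> d (repr (coset H x)) = d x.
Proof.
move=> Zd Ax; have [h Hh ->] := repr_cosetP (nA Ax).
exact: rel_cocycle_mull.
Qed.

(** Expanding [d (h * x) = d x] by the cocycle relation with [d h = 0] gives [act h (d x) = d x]. *)
Lemma rel_cocycle_fixed d x : rel_cocycle H A d -> x \in A -> fixed H (d x).
Proof.
move=> Zd Ax; have [Md dM d0] := Zd; split=> [|h Hh]; first exact: Md.
by rewrite -{2}(rel_cocycle_mull Zd Hh Ax) dM ?(HA Hh) // (d0 _ Hh) add0r.
Qed.

Lemma inflation_le :
  (dim_H1 (@cact H) (A / H)%g (fixed H) <= dim_rel_H1 H A)%E.
Proof.
have lin := @cact_lin H.
apply: (@le_quot_dim _ _ _ (pullback (coset H) [set: gT])).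
- exact: subspace_cocycle (subspace_fixed H).
- exact: subspace_coboundary (subspace_fixed H).
- exact: subspace_rel_coboundary.
- move=> d [[Bd _] dM]; split=> [x Ax|x y Ax Ay|h Hh]; rewrite !ffunE !inE.
  + by have [] := Bd _ (mem_quotient H Ax).
  + rewrite morphM ?nA //= dM ?mem_quotient // /cact act_repr ?nA //.
    exact: Bd (mem_quotient H Ay).
  (* [h] goes to the trivial coset, where the cocycle relation at [1 * 1] reads
     [d 1 = d 1 + d 1]. *)
  + have := dM 1%g 1%g (group1 _) (group1 _); rewrite mulg1 coset_id //.
    by rewrite /cact repr_coset1 act1 => /eqP; rewrite addrC -subr_eq subrr => /eqP.
- move=> d [Cd _] [b fb db]; split=> //; exists b => // y Ay.
  have Ary := mem_repr_quotient Ay.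
  by have := db _ Ary; rewrite ffunE inE coset_reprK.
Qed.

Lemma deflation_cocycle d : rel_cocycle H A d ->
  cocycle (@cact H) (A / H)%g (fixed H)
    (pullback (repr : coset_of H -> gT) (A / H)%g d).
Proof.
move=> Zd; have [Md dM d0] := Zd; split.
  split=> y Ay; rewrite ffunE ?Ay; last by rewrite (negPf Ay).
  exact: rel_cocycle_fixed (mem_repr_quotient Ay).
move=> x y Ax Ay; rewrite !ffunE Ax Ay groupM //.
have [Arx Ary] := (mem_repr_quotient Ax, mem_repr_quotient Ay).
rewrite -{1}[x]coset_reprK -{1}[y]coset_reprK -morphM ?nA //=.
by rewrite rel_cocycle_repr ?groupM // dM.
Qed.

Lemma deflation_coboundary d : rel_cocycle H A d ->
  coboundary (@cact H) (A / H)%g (fixed H)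
    (pullback (repr : coset_of H -> gT) (A / H)%g d) ->
  rel_coboundary H A d.
Proof.
move=> Zd [_ [b fb db]]; exists b => // x Ax; have AHx := mem_quotient H Ax.
by rewrite -rel_cocycle_repr // -(act_repr (nA Ax) fb) -db // ffunE AHx.
Qed.

Lemma deflation_le :
  (dim_rel_H1 H A <= dim_H1 (@cact H) (A / H)%g (fixed H))%E.
Proof.
have lin := @cact_lin H.
apply: (@le_quot_dim _ _ _ (pullback (repr : coset_of H -> gT) (A / H)%g)).
- exact: subspace_rel_cocycle.
- exact: subspace_rel_coboundary.
- exact: subspace_coboundary (subspace_fixed H).
- exact: deflation_cocycle.
- exact: deflation_coboundary.
Qed.

(** Injectivity of inflation: if [d] is the coboundary of [b] on [A], then [0 = d h = act h b - b]
    for [h] in [H], so [b] is fixed by [H]. *)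
Lemma dim_rel_H1_le : (dim_rel_H1 H A <= dim_H1 act A M)%E.
Proof.
apply: (@le_quot_dim _ _ _ (pullback id A)).
- exact: subspace_rel_cocycle.
- exact: subspace_rel_coboundary.
- exact: subspace_coboundary.
- move=> d [Md dM _]; split=> [|x y Ax Ay].
    by split=> x Ax; rewrite ffunE ?Ax ?(negPf Ax) //; apply: Md.
  by rewrite !ffunE Ax Ay groupM // dM.
- move=> d [_ _ d0] [_ [b Mb db]]; have db' x (Ax : x \in A) : d x = act x b - b.
    by rewrite -db // ffunE Ax.
  exists b => //; split=> // h Hh; apply/eqP; rewrite -subr_eq0 -db' ?(HA Hh) //.
  exact/eqP/d0.
Qed.

End Quotient.

Lemma dim_rel_H1_self (A : {group gT}) : dim_rel_H1 A A = 0%E.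
Proof.
apply: quot_dim0 => [|d [_ _ d0]]; first exact: subspace_rel_coboundary.
exists 0 => [|x Ax]; first exact: subspace0 (subspace_fixed A).
by rewrite d0 // (lin_act0 act_lin) // subr0.
Qed.

Lemma dim_H1_le_rel (A : {group gT}) :
  (dim_H1 act A M <= dim_rel_H1 1%G A)%E.
Proof.
apply: (@le_quot_dim _ _ _ idfun).
- exact: subspace_cocycle.
- exact: subspace_coboundary.
- exact: subspace_rel_coboundary.
- move=> d [[Md _] dM]; split=> // h /set1P ->.
  have := dM _ _ (group1 A) (group1 A); rewrite mulg1 act1 => /eqP.
  by rewrite addrC -subr_eq subrr => /eqP.
- by move=> d [Cd _] [b [Mb _] db]; split=> //; exists b.
Qed.

(* On [Gam], [d a + act a (d r) = d (a * r) = d (r * a ^ r)] makes the conjugate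
   of [d] by [r] differ from [d] by the coboundary of [d r]. *)
Lemma restriction_invariant (H A Gam : {group gT}) d :
  H <| A -> A <| Gam -> H <| Gam -> rel_cocycle H Gam d ->
  invariant_cocycle (@cact H) (A / H)%g (fixed H) (Gam / H)%g
    (pullback (repr : coset_of H -> gT) (A / H)%g d).
Proof.
move=> nHA nAG nHG Zd; have [Md dM d0] := Zd.
have AG : {subset A <= Gam} := fintype.subsetP (normal_sub nAG).
have ZAd : rel_cocycle H A d.
  by split=> [x /AG|x y /AG Gx /AG|//]; [apply: Md | apply: dM].
split=> [|s Gs]; first exact: deflation_cocycle.
have Gr := mem_repr_quotient nHG Gs; set r := repr s in Gr.
have nGH : {subset Gam <= 'N(H)} := fintype.subsetP (normal_norm nHG).
have nGs : s \in 'N(A / H)%g.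
  by apply: fintype.subsetP (normal_norm (quotient_normal H nAG)) _ Gs.
have E x : x \in (A / H)%g -> (conj_cochain (@cact H) s
    (pullback (repr : coset_of H -> gT) (A / H)%g d) -
    pullback (repr : coset_of H -> gT) (A / H)%g d) x =
    act (repr x) (d r) - d r.
  move=> Ax; have Ga := AG _ (mem_repr_quotient nHA Ax); set a := repr x in Ga *.
  rewrite !ffunE memJ_norm // Ax.
  have -> : (x ^ s)%g = coset H (a ^ r)%g.
    by rewrite morphJ ?nGH //= !coset_reprK.
  rewrite (rel_cocycle_repr nHG) ?groupJ // /cact -/a.
  have: d (a * r)%g = d r + act r (d (a ^ r)%g) by rewrite conjgC dM ?groupJ.
  rewrite dM // => e; apply/eqP; rewrite subr_eq -(inj_eq (addrI (d r))) -e.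
  by rewrite [in eqbRHS]addrA [X in _ == X + _]addrC subrK addrC.
split.
  split=> x Ax; last first.
    by rewrite !ffunE memJ_norm // (negPf Ax) /cact (lin_act0 act_lin) // subr0.
  rewrite E //; have fr := rel_cocycle_fixed nHG Zd Gr.
  apply: (subspaceB (subspace_fixed H)) => //.
  exact: fixed_norm (repr_coset_norm x) fr.
exists (d r) => [|x Ax]; last exact: E.
exact: (rel_cocycle_fixed nHG Zd Gr).
Qed.

(** Exactness in the middle: if the restriction of [d] to [A] is the coboundary of a vector [b]
    fixed by [H], subtracting from [d] the coboundary of [b] on the whole of [Gam] makes it vanish
    on [A], hence inflated from [Gam / A]. *)
Lemma inflation_restriction (H A Gam : {group gT}) :
  H <| A -> A <| Gam -> H <| Gam ->
  (dim_rel_H1 H Gam <= dim_rel_H1 A Gam +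
     dim_H1_inv (@cact H) (A / H)%g (fixed H) (Gam / H)%g)%E.
Proof.
move=> nHA nAG nHG.
have AG : {subset A <= Gam} := fintype.subsetP (normal_sub nAG).
have fAH v : fixed A v -> fixed H v.
  by move=> [Mv fv]; split=> // h /(fintype.subsetP (normal_sub nHA)); apply: fv.
apply: (@quot_dim_exact _ _ _ (pullback (repr : coset_of H -> gT) (A / H)%g)).
- exact: subspace_rel_cocycle.
- exact: subspace_rel_coboundary.
- exact: (subspace_coboundary (@cact_lin H) _ (subspace_fixed H)).
- by move=> d; apply: restriction_invariant.
- exact: subspace_rel_coboundary.
- move=> d Zd Bd; have [Md dM d0] := Zd.
  have [|b fb db] := deflation_coboundary nHA _ Bd.
    by split=> [x /AG|x y /AG Gx /AG|//]; [apply: Md | apply: dM].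
  exists (d - [ffun x => act x b - b]); last first.
    by exists b => // x _; rewrite opprB addrC subrK ffunE.
  split=> [x Gx|x y Gx Gy|x Ax]; rewrite !ffunE.
  + apply: (subspaceB subM); first exact: Md.
    by apply: (subspaceB subM); [exact: stabM fb.1 | exact: fb.1].
  + rewrite dM // actM !(lin_actB act_lin) // [RHS]addrACA -opprD.
    by congr (_ - _); rewrite [RHS]addrC addrA subrK.
  + by rewrite db // subrr.
- by move=> d [b fb db]; exists b => //; apply: fAH.
Qed.

Lemma dim_H1_quot_le (H Gam : {group gT}) : H <| Gam ->
  (dim_H1 (@cact H) (Gam / H)%g (fixed H) <= dim_H1 act Gam M)%E.
Proof.
by move=> nHG; apply: le_trans (inflation_le nHG) (dim_rel_H1_le nHG).
Qed.

(** The quotient by the trivial group lives on another type, [coset_of 1]; both inequalities pass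
    through [dim_rel_H1 1%G Gam]. *)
Lemma dim_H1_quot1 (Gam : {group gT}) :
  dim_H1 (@cact 1%G) (Gam / 1%G)%g (fixed 1%G) = dim_H1 act Gam M.
Proof.
apply/le_anti; rewrite dim_H1_quot_le ?normal1 //=.
exact: le_trans (dim_H1_le_rel Gam) (deflation_le (normal1 Gam)).
Qed.

Lemma dim_H1_le_filtration (f : nat) (S : nat -> {group gT}) :
  S 0 = 1%G -> (forall i, (i <= f)%N -> S i <| S f) ->
  (forall i, (i < f)%N -> S i \subset S i.+1) ->
  (dim_H1 act (S f) M <=
     \sum_(1 <= i < f.+1)
       dim_H1_inv (@cact (S i.-1)) (S i / S i.-1)%g (fixed (S i.-1))
         (S f / S i.-1)%g)%E.
Proof.
move=> S0 nS sS.
suff step j : (j <= f)%N -> (dim_H1 act (S f) M <= dim_rel_H1 (S j) (S f) +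
    \sum_(1 <= i < j.+1)
       dim_H1_inv (@cact (S i.-1)) (S i / S i.-1)%g (fixed (S i.-1))
         (S f / S i.-1)%g)%E.
  by have := step f (leqnn f); rewrite dim_rel_H1_self add0e.
elim: j => [_|j IHj lt_jf].
  by rewrite big_geq // adde0 S0; apply: dim_H1_le_rel.
apply: le_trans (IHj (ltnW lt_jf)) _; rewrite [in leRHS]big_nat_recr //= addeA.
rewrite [in leRHS]addeAC; apply: leeD2r.
have nj := nS _ (ltnW lt_jf); apply: inflation_restriction => //; last exact: nS.
exact: normalS (sS _ lt_jf) (normal_sub (nS _ lt_jf)) nj.
Qed.

End InflationRestriction.

(** * The t-adic filtration *)

Section FormalSeries.
Variable k : fieldType.
Implicit Types a b c : fps k.
Local Notation X := (fps_var k).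
Local Notation L := (laurent k).
Local Notation t := (tvar k).

Lemma fcoef_const (x : k) n : fcoef (fps_const x) n = x *+ (n == 0).
Proof. by []. Qed.

Lemma fcoefXM a n : fcoef (X * a) n = if n is m.+1 then fcoef a m else 0.
Proof.
rewrite fcoefM; case: n => [|n]; first by rewrite big_ord_recl big_ord0 mul0r addr0.
rewrite 2!big_ord_recl /= mul0r mul1r add0r big1 ?addr0 => [|i _].
  by rewrite /bump /= subn1.
by rewrite mul0r.
Qed.

Lemma fcoefXnM a n : fcoef (X ^+ n * a) n = fcoef a 0.
Proof.
by elim: n => [|n IHn]; [rewrite expr0 mul1r | rewrite exprS -mulrA fcoefXM].
Qed.

Definition fps_tail a : fps k := FPS (fun n => fcoef a n.+1).

(** The recursion behind the later inductions: when two expressions in [a] obey it alike, each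
    application extracts one more factor from their difference, which is then divisible by every
    [X ^+ n]. *)
Lemma fps_headtail a : a = fps_const (fcoef a 0) + X * fps_tail a.
Proof.
by apply: fpsP => -[|n]; rewrite fcoefD fcoefXM fcoef_const ?addr0 ?add0r.
Qed.

(** [a] lies in [t^n k[[t]]]. *)
Definition xdvd n a : Prop := forall i, (i < n)%N -> fcoef a i = 0.

Lemma xdvd0 n : xdvd n 0. Proof. by []. Qed.
Lemma xdvdD n a b : xdvd n a -> xdvd n b -> xdvd n (a + b).
Proof. by move=> da db i lt_i; rewrite fcoefD da // db // addr0. Qed.
Lemma xdvdN n a : xdvd n a -> xdvd n (- a).
Proof. by move=> da i lt_i; rewrite fcoefN da // oppr0. Qed.
Lemma xdvdB n a b : xdvd n a -> xdvd n b -> xdvd n (a - b).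
Proof. by move=> da /xdvdN; apply: xdvdD. Qed.
Lemma xdvd_leq m n a : (m <= n)%N -> xdvd n a -> xdvd m a.
Proof. by move=> le_mn da i lt_i; apply/da/(leq_trans lt_i). Qed.

Lemma xdvdP n a : xdvd n a <-> exists b, a = X ^+ n * b.
Proof.
split=> [|[b ->]]; last first.
  elim: n b => [|n IHn] b // [|i] lt_i; rewrite exprS -mulrA fcoefXM //.
  exact: IHn.
elim: n a => [|n IHn] a da; first by exists a; rewrite mul1r.
have [i lt_i|b eb] := IHn (fps_tail a); first exact: da.
exists b; rewrite [LHS]fps_headtail da // rmorph0 add0r eb.
by rewrite exprS mulrA.
Qed.

Lemma xdvdM m n a b : xdvd m a -> xdvd n b -> xdvd (m + n) (a * b).
Proof.
move=> /xdvdP[c ->] /xdvdP[d ->]; apply/xdvdP; exists (c * d).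
by rewrite mulrACA exprD.
Qed.

Lemma xdvdMl n a b : xdvd n b -> xdvd n (a * b).
Proof. by move=> db; rewrite -[n]add0n; apply: xdvdM. Qed.

Lemma xdvdMr n a b : xdvd n a -> xdvd n (a * b).
Proof. by rewrite mulrC; apply: xdvdMl. Qed.

Lemma xdvdX a n : xdvd 1 a -> xdvd n (a ^+ n).
Proof.
move=> da; elim: n => [|n IHn] //; rewrite exprS -add1n; exact: xdvdM.
Qed.

Lemma xdvd_eq0 a : (forall n, xdvd n a) -> a = 0.
Proof. by move=> da; apply: fpsP => n; rewrite (da n.+1). Qed.

Lemma xdvd_ord n a : a != 0 -> xdvd n a <-> (n <= fps_ord a)%N.
Proof.
move=> /fps_ordP[an0 alt]; split=> [da|le_n i lt_i].
  by rewrite leqNgt; apply: contra an0 => /da ->.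
exact/alt/(leq_trans lt_i).
Qed.

(** The sum of a series whose [i]-th term is divisible by [t^i]. *)
Definition fps_series (c : nat -> fps k) : fps k :=
  FPS (fun m => fcoef (\sum_(i < m.+1) c i) m).

Lemma fcoef_sum (I : Type) (r : seq I) (P : pred I) (c : I -> fps k) n :
  fcoef (\sum_(i <- r | P i) c i) n = \sum_(i <- r | P i) fcoef (c i) n.
Proof. by elim/big_rec2: _ => [|i y x _ <-]. Qed.

Lemma fps_seriesP (c : nat -> fps k) n : (forall i, xdvd i (c i)) ->
  xdvd n (fps_series c - \sum_(i < n) c i).
Proof.
move=> dc m lt_mn; apply/eqP; rewrite fcoefD fcoefN subr_eq0 /=.
rewrite !fcoef_sum (big_ord_widen _ (fun i => fcoef (c i) m) lt_mn).
rewrite big_mkcond /=; apply/eqP; apply: eq_bigr => i _; case: ltnP => // lt_mi.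
by rewrite dc.
Qed.

(** Up to the constant [fcoef a 0], [a] is [1 - v] with [v] divisible by [X], and the inverse is the
    geometric series of [v]. *)
Lemma fps_unit_coef0 a : fcoef a 0 != 0 -> exists b, b * a = 1.
Proof.
move=> a0; pose v := 1 - fps_const (fcoef a 0)^-1 * a.
have dv : xdvd 1 v.
  move=> [|//] _; rewrite fcoefD fcoefN fcoef1 fcoefM big_ord1 /=.
  by rewrite mulVf // subrr.
pose b := fps_series (fun i => v ^+ i).
have bE : b * (1 - v) = 1.
  apply/eqP; rewrite -subr_eq0; apply/eqP; apply: xdvd_eq0 => n.
  have := @fps_seriesP (fun i => v ^+ i) n (fun=> xdvdX dv).
  rewrite -/b; move: b => b db.
  (* The error splits into the tail of the series and the defect of the finite geometric sum, both
     divisible by [X ^+ n]. *)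
  have -> : b * (1 - v) - 1 = (b - \sum_(i < n) v ^+ i) * (1 - v) - v ^+ n.
    have -> : v ^+ n = 1 - (1 - v) * \sum_(i < n) v ^+ i.
      by rewrite -[LHS](subrK 1) subrX1; ring.
    ring.
  by apply: xdvdB; [apply: xdvdMr | apply: xdvdX].
by exists (b * fps_const (fcoef a 0)^-1); rewrite -mulrA -[_ * a](subKr 1).
Qed.

(** The condition [v_t >= n] in a form free of the fraction chosen in [val_t]; the equivalence is
    [val_ge_tO]. *)
Definition tO n : set L := fun x => exists a, x = t ^+ n * of_fps a.

Lemma tO_of_fps n a : tO n (of_fps a) <-> xdvd n a.
Proof.
rewrite xdvdP; split=> -[b e]; exists b.
  by apply: of_fps_inj; rewrite rmorphM rmorphXn.
by rewrite e rmorphM rmorphXn.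
Qed.

Lemma tO0P x : tO 0 x <-> exists a, x = of_fps a.
Proof. by split=> -[a ->]; exists a; rewrite mul1r. Qed.

Lemma tOP n x : tO n x <-> exists2 a, x = of_fps a & xdvd n a.
Proof.
split=> [[a ->]|[a -> /tO_of_fps//]]; exists (X ^+ n * a).
  by rewrite rmorphM rmorphXn.
by apply/xdvdP; exists a.
Qed.

Lemma tO_leq m n x : (m <= n)%N -> tO n x -> tO m x.
Proof.
by move=> le_mn /tOP[a -> /(xdvd_leq le_mn) da]; apply/tO_of_fps.
Qed.

Lemma tO_0 n : tO n 0. Proof. by exists 0; rewrite rmorph0 mulr0. Qed.
Lemma tOD n x y : tO n x -> tO n y -> tO n (x + y).
Proof. by move=> [a ->] [b ->]; exists (a + b); rewrite rmorphD mulrDr. Qed.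
Lemma tON n x : tO n x -> tO n (- x).
Proof. by move=> [a ->]; exists (- a); rewrite rmorphN mulrN. Qed.
Lemma tOB n x y : tO n x -> tO n y -> tO n (x - y).
Proof. by move=> ? /tON; apply: tOD. Qed.
Lemma tOM m n x y : tO m x -> tO n y -> tO (m + n) (x * y).
Proof.
by move=> [a ->] [b ->]; exists (a * b); rewrite rmorphM exprD mulrACA.
Qed.
Lemma tOMl n x y : tO 0 x -> tO n y -> tO n (x * y).
Proof. exact: tOM. Qed.
Lemma tOX n x : tO 1 x -> tO n (x ^+ n).
Proof.
move=> dx; elim: n => [|n IHn]; first by exists 1; rewrite rmorph1 mulr1.
by rewrite exprS -add1n; apply: tOM.
Qed.
Lemma tOZ n (c : k) x : tO n x -> tO n (c *: x).
Proof. by apply: tOMl; apply/tO0P; exists (fps_const c). Qed.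
Lemma tO_tvar : tO 1 t.
Proof. by exists 1; rewrite rmorph1 mulr1. Qed.

Lemma tvar_neq0 : t != 0.
Proof.
by rewrite of_fps_eq0; apply/eqP => /(congr1 (fun a => fcoef a 1))/eqP;
  rewrite /= oner_eq0.
Qed.

Lemma tO_eq0 x : (forall n, tO n x) -> x = 0.
Proof.
move=> dx; have /tO0P[a e] := dx 0; rewrite {}e in dx *.
by rewrite (@xdvd_eq0 a) ?rmorph0 // => n; apply/tO_of_fps.
Qed.

(** For nonzero [x] the denominator is [X ^+ e * u] with [u] invertible, so [x] is [t ^+ n] times a
    series exactly when the numerator has order at least [n + e]. *)
Lemma val_ge_tO n x : (((n%:Z)%:E <= val_t x)%E : Prop) <-> tO n x.
Proof.
have [->|x0] := eqVneq x 0.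
  by split=> _; [apply: tO_0 | rewrite /val_t eqxx leey].
have n0 : num x != 0.
  by apply: contraNneq x0 => e; rewrite [x]num_den e rmorph0 mul0r.
have d0 := den_neq0 x; have dn0 : of_fps (den x) != 0 by rewrite of_fps_eq0.
rewrite {1}[x]num_den val_t_frac // lee_fin lerBrDr -PoszD lez_nat.
have /xdvdP[u eu] : xdvd (fps_ord (den x)) (den x) by apply/xdvd_ord.
have [v vu1] : exists v, v * u = 1.
  apply: fps_unit_coef0; have := (fps_ordP d0).1; rewrite {1}eu.
  by rewrite fcoefXnM.
split=> [|[a ea]].
  move=> /(xdvd_ord _ n0)/xdvdP[b eb]; exists (v * b).
  apply: (mulIf dn0); rewrite {1}[x]num_den mulfVK // eb {2}eu.
  rewrite -mulrA -rmorphM -rmorphXn -rmorphM; congr of_fps.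
  rewrite exprD -{1}[b]mul1r -vu1; move: (X ^+ n) (X ^+ _) => p q.
  by rewrite -!mulrA; congr (_ * _); rewrite [b * _]mulrCA [RHS]mulrCA [u * b]mulrC.
apply/(xdvd_ord _ n0); have -> : num x = X ^+ n * a * den x.
  apply: of_fps_inj; rewrite [RHS]rmorphM /= [of_fps (_ * a)]rmorphM rmorphXn -ea.
  by rewrite [X in _ = X * _]num_den mulfVK.
by apply: xdvdM; [apply/xdvdP; exists a | apply/xdvd_ord].
Qed.

Lemma ddt_tO x : tO 0 x -> tO 0 (ddt x).
Proof.
by move=> /tO0P[a ->]; rewrite ddt_of_fps; apply/tO0P; exists (fps_deriv a).
Qed.

End FormalSeries.

(** * Ramification groups *)

Section Automorphism.
Variable k : fieldType.
Local Notation X := (fps_var k).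
Local Notation L := (laurent k).
Local Notation t := (tvar k).
Variable s : {lrmorphism L -> L}.

Lemma tO1_root (x : L) n : (0 < n)%N -> tO 1 (x ^+ n) -> tO 1 x.
Proof.
move=> n_gt0 /val_ge_tO; have [->|x0] := eqVneq x 0; first by move=> _; apply: tO_0.
move=> val_xn; apply/val_ge_tO; move: val_xn.
have n0 : num x != 0.
  by apply: contraNneq x0 => e; rewrite [x]num_den e rmorph0 mul0r.
have ordX (a : fps k) m : a != 0 -> fps_ord (a ^+ m) = (m * fps_ord a)%N.
  move=> a0; elim: m => [|m IHm]; first by rewrite (@fps_ord_eq _ _ 0) ?oner_eq0.
  by rewrite exprS fps_ordM ?expf_neq0 // IHm mulSn.
rewrite [x]num_den; move: (num x) (den x) n0 (den_neq0 x) => a b a0 b0.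
rewrite expr_div_n -!rmorphXn !val_t_frac ?expf_neq0 //.
rewrite !ordX // !lee_fin; nia.
Qed.

Hypothesis s_cont : continuous_t s.

(** Continuity at 0 only says that [s (t ^+ N)] has positive valuation for large [N]. This valuation
    is [N] times that of [s t], which is therefore positive. *)
Lemma continuous_tvar : tO 1 (s t).
Proof.
have [m mP] := s_cont 0 1; have {mP} := mP (t ^+ `|m|.+1).
rewrite !rmorph0 !subr0 rmorphXn => mP; apply: (@tO1_root _ `|m|.+1) => //.
apply/val_ge_tO; apply: mP; apply: (@le_trans _ _ (`|m|.+1%:Z)%:E).
  by rewrite lee_fin; lia.
exact/val_ge_tO/tOX/tO_tvar.
Qed.

Lemma of_fps_headtail (a : fps k) :
  of_fps a = of_fps (fps_const (fcoef a 0)) + t * of_fps (fps_tail a).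
Proof. by rewrite {1}[a]fps_headtail rmorphD rmorphM. Qed.

Lemma fix_const c : s (of_fps (fps_const c)) = of_fps (fps_const c).
Proof.
by rewrite -[of_fps _]mulr1 -[_ * 1]/(c *: (1 : L)) linearZ_LR rmorph1.
Qed.

(** Continuity controls [s] only on [t^N k[[t]]] with [N] the absolute value of [m]. The exponent is
    lowered one step at a time: the constant term split off contributes a constant times a power of
    [s t], which is integral. *)
Lemma continuous_of_fps (a : fps k) : tO 0 (s (of_fps a)).
Proof.
have [m mP] := s_cont 0 0.
have sO (x : L) : tO `|m| x -> tO 0 (s x).
  move=> dx; apply/val_ge_tO; have := mP x; rewrite !rmorph0 !subr0; apply.
  apply: (@le_trans _ _ (`|m|%:Z)%:E); first by rewrite lee_fin; lia.
  exact/val_ge_tO.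
have st0 : tO 0 (s t) by apply: (@tO_leq _ 0 1) => //; apply: continuous_tvar.
suff : forall n (a : fps k), tO 0 (s (t ^+ (`|m| - n) * of_fps a)).
  by move=> /(_ `|m|%N a); rewrite subnn mul1r.
elim=> [|n IHn] b; first by rewrite subn0; apply: sO; exists b.
have [le_mn|lt_nm] := leqP `|m|%N n.
  by have := IHn b; rewrite (_ : `|m| - n.+1 = `|m| - n)%N //; lia.
rewrite of_fps_headtail mulrDr mulrA -exprSr subnSK // rmorphD.
apply: tOD; last exact: IHn.
rewrite rmorphM /= fix_const rmorphXn /=.
elim: (`|m| - _)%N => [|j IHj]; last by rewrite exprS -mulrA; apply: tOMl.
by apply/tO0P; exists (fps_const (fcoef b 0)); rewrite mul1r.
Qed.

Lemma continuous_tO n (x : L) : tO n x -> tO n (s x).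
Proof.
move=> [a ->]; rewrite rmorphM rmorphXn -[n]addn0; apply: tOM.
  by rewrite addn0; apply/tOX/continuous_tvar.
exact: continuous_of_fps.
Qed.

Let phi_ex : {phi : fps k -> fps k | forall a, of_fps (phi a) = s (of_fps a)}.
Proof.
apply: cid; exists (fun a => projT1 (cid ((tO0P _).1 (continuous_of_fps a)))) => a.
by case: cid.
Qed.

Lemma ddt_chain (x : L) : tO 0 x -> ddt (s x) = s (ddt x) * ddt (s t).
Proof.
move=> /tO0P[a ->]; have [phi phiE] := phi_ex.
have phiD a1 a2 : phi (a1 + a2) = phi a1 + phi a2.
  by apply: of_fps_inj; rewrite rmorphD /= !phiE !rmorphD.
have phiM a1 a2 : phi (a1 * a2) = phi a1 * phi a2.
  by apply: of_fps_inj; rewrite rmorphM /= !phiE !rmorphM.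
have phiC c : phi (fps_const c) = fps_const c.
  by apply: of_fps_inj; rewrite phiE fix_const.
have phi1 : phi 1 = 1 by apply: of_fps_inj; rewrite phiE !rmorph1.
have DD (a1 a2 : fps k) : fps_deriv (a1 + a2) = fps_deriv a1 + fps_deriv a2.
  by apply: fpsP => n /=; rewrite mulrnDl.
have DC c : fps_deriv (fps_const c) = 0 :> fps k.
  by apply: fpsP => n /=; rewrite mulr0n mul0rn.
have DX : fps_deriv X = 1 :> fps k by apply: fpsP => -[|n] //=; rewrite mul0rn.
have phi0 : phi 0 = 0 by apply: of_fps_inj; rewrite phiE !rmorph0.
rewrite -phiE !ddt_of_fps -phiE -[s t]phiE ddt_of_fps -rmorphM; congr of_fps.
apply/eqP; rewrite -subr_eq0; apply/eqP/xdvd_eq0 => n.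
(* The defect of the chain rule. Splitting off the constant term gives
   [E a = phi X * E (fps_tail a)], and [phi X] is divisible by [X], so [E a] is divisible by every
   power of [X]. *)
pose E b := fps_deriv (phi b) - phi (fps_deriv b) * fps_deriv (phi X).
rewrite -/(E a); elim: n a => [//|n IHn] a.
suff -> : E a = phi X * E (fps_tail a).
  rewrite -add1n; apply: xdvdM => //; apply/tO_of_fps; rewrite phiE.
  exact: continuous_tvar.
rewrite /E {1 2}[a]fps_headtail !phiD !DD phiC !DC phiM !fps_derivM !phiD phi0.
rewrite !phiM DX phi1 !add0r; move: (fps_deriv _) (phi _) (fps_deriv _) => u v w.
by rewrite !mul1r mulrDl opprD addrACA [w * v]mulrC subrr add0r mulrBr mulrA.
Qed.

(** Induction on the order: in [(s t - t) * s b + t * (s b - b)] the factor [t] gains one order for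
    the second term. Hence the condition defining [ram] passes from [t] to all integral elements. *)
Lemma tO_displacement i (x : L) : tO i (s t - t) -> tO 0 x -> tO i (s x - x).
Proof.
move=> di /tO0P[a ->].
suff H m : (m <= i)%N -> forall a, tO m (s (of_fps a) - of_fps a) by apply: H.
elim: m => [|m IHm] lt_mi {}a.
  by apply: tOB; [apply: continuous_of_fps | apply/tO0P; exists a].
rewrite of_fps_headtail rmorphD /= fix_const opprD addrACA subrr add0r.
rewrite rmorphM; set b := of_fps _.
have -> : s t * s b - t * b = (s t - t) * s b + t * (s b - b) by ring.
apply: tOD; last by rewrite -add1n; apply: tOM (IHm (ltnW lt_mi) _); apply: tO_tvar.
by rewrite mulrC; apply: tOMl (tO_leq lt_mi di); apply: continuous_of_fps.
Qed.

End Automorphism.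

Section RamificationGroups.
Local Open Scope group_scope.
Local Open Scope ring_scope.
Variables (k : fieldType) (gT : finGroupType).
Local Notation L := (laurent k).
Local Notation t := (tvar k).
Variable rho : gT -> {lrmorphism L -> L}.
Hypothesis rho1 : forall x, rho 1%g x = x.
Hypothesis rhoM : forall g h x, rho (g * h)%g x = rho g (rho h x).
Hypothesis rho_cont : forall g, continuous_t (rho g).

Lemma ramP i g : reflect (tO i.+1 (rho g t - t)) (g \in ram rho i).
Proof. by rewrite inE; apply: (iffP idP) => /val_ge_tO. Qed.

Lemma ram_group_set i : group_set (ram rho i).
Proof.
apply/group_setP; split=> [|g h /ramP dg /ramP dh]; apply/ramP.
  by rewrite rho1 subrr; apply: tO_0.
rewrite rhoM -(subrK (rho g t) (rho g (rho h t))) -rmorphB -addrA.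
by apply: tOD => //; apply: continuous_tO.
Qed.
Canonical ram_group i : {group gT} := Group (ram_group_set i).

Lemma ram_sub i j : (i <= j)%N -> ram rho j \subset ram rho i.
Proof.
move=> le_ij; apply/fintype.subsetP => g /ramP dg; apply/ramP.
exact: tO_leq dg.
Qed.

(** The displacement of [t] by [h ^ g] is the image under [g^-1] of the displacement of [g t] by
    [h], and [g t] is integral. *)
Lemma ram_norm i g : g \in 'N(ram rho i).
Proof.
rewrite inE; apply/fintype.subsetP => _ /imsetP[h /ramP dh ->]; apply/ramP.
rewrite /conjg !rhoM.
have {2}-> : t = rho g^-1%g (rho g t) by rewrite -rhoM mulVg rho1.
rewrite -rmorphB; apply: continuous_tO => //; apply: tO_displacement => //.
by apply: continuous_tO => //; apply: (@tO_leq _ 0 1) => //; apply: tO_tvar.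
Qed.

Lemma ram_normal i j : (i <= j)%N -> ram_group j <| ram_group i.
Proof.
move=> le_ij; apply/andP; split; first exact: ram_sub.
by apply/fintype.subsetP => g _; apply: ram_norm.
Qed.

Local Notation act := (derivation_act rho).

Lemma derivation_act_lin g : linear (act g).
Proof. by move=> c x y; rewrite /derivation_act linearP mulrDl scalerAl. Qed.

Lemma derivation_act1 x : act 1%g x = x.
Proof.
rewrite /derivation_act invg1 !rho1 /tvar ddt_of_fps.
suff -> : fps_deriv (fps_var k) = 1 by rewrite rmorph1 mulr1.
by apply: fpsP => -[|n] //=; rewrite mul0rn.
Qed.

(** The chain rule for [h^-1] at [g^-1 t] splits the derivative; on the factor coming from
    [ddt (g^-1 t)] the action of [h] cancels that of [h^-1]. *)
Lemma derivation_actM g h x : act (g * h)%g x = act g (act h x).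
Proof.
rewrite /derivation_act invMg !rhoM ddt_chain //; last first.
  by apply: continuous_tO => //; apply: (@tO_leq _ 0 1) => //; apply: tO_tvar.
move: (ddt (rho g^-1%g t)) (ddt (rho h^-1%g t)) => u v.
by rewrite !rmorphM /= -(rhoM h) mulgV rho1 mulrA mulrAC.
Qed.

Lemma TO_tO x : @TO k x <-> tO 0 x.
Proof. by rewrite tO0P; split=> [[a _ <-]|[a ->]]; exists a. Qed.

Lemma subspace_TO : subspace (@TO k).
Proof.
split=> [|c x y]; first exact/TO_tO/tO_0.
by rewrite !TO_tO => dx dy; apply: tOD => //; apply: tOZ.
Qed.

Lemma derivation_act_TO g x : @TO k x -> @TO k (act g x).
Proof.
rewrite !TO_tO => dx; apply: tOMl; first exact: continuous_tO.
apply/continuous_tO/ddt_tO/continuous_tO => //.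
by apply: (@tO_leq _ 0 1) => //; apply: tO_tvar.
Qed.

Section Jumps.
Variables (f : nat) (u : nat -> nat).
Hypothesis jumps : jump_sequence rho f u.

Lemma jump_succ i : (i < f)%N -> (u i.+1 <= u i)%N.
Proof.
case: i => [|i] lt_if; first by rewrite (jump_zero jumps).
by apply/ltnW/(jump_decreasing jumps).
Qed.

Lemma jump_last_le i : (i <= f)%N -> (u f <= u i)%N.
Proof.
move=> le_if; rewrite -(subKn le_if); elim: (f - i)%N => [|j IHj].
  by rewrite subn0.
have [le_fj|lt_jf] := leqP f j.
  by rewrite (_ : f - j.+1 = f - j)%N //; lia.
apply: leq_trans IHj _; rewrite -(subnSK lt_jf); apply: jump_succ.
by rewrite subnSK // leq_subr.
Qed.

Lemma ram_jump_last : ram rho (u f) = ram rho 1.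
Proof. by apply: (jump_first_block jumps); rewrite (jump_last_pos jumps) /=. Qed.

Lemma jump_dim_bounds :
  [/\ (dim_H1_quot rho (ram rho 1) (ram rho (u f.-1)) <= dim_H1_TO rho)%E,
      (dim_H1_TO rho <=
         \sum_(1 <= i < f.+1)
           dim_H1_quot_inv rho (ram rho (u f)) (ram rho (u i))
             (ram rho (u i.-1)))%E
    & (\sum_(1 <= i < f.+1)
         dim_H1_quot_inv rho (ram rho (u f)) (ram rho (u i))
           (ram rho (u i.-1)) <=
       \sum_(1 <= i < f.+1)
         dim_H1_quot rho (ram rho (u i)) (ram rho (u i.-1)))%E].
Proof.
have normal_last i : (i <= f)%N -> ram_group (u i) <| ram_group (u f).
  by move=> /jump_last_le/ram_normal.
split.
- rewrite /dim_H1_TO -ram_jump_last.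
  exact: (dim_H1_quot_le derivation_act_lin derivation_act1 derivation_actM
    subspace_TO derivation_act_TO (normal_last _ (leq_pred f))).
- rewrite /dim_H1_TO -ram_jump_last.
  apply: (@dim_H1_le_filtration _ _ _ _ derivation_act_lin derivation_act1
    derivation_actM _ subspace_TO derivation_act_TO f (fun i => ram_group (u i))).
  + by apply: val_inj; apply: (jump_end jumps).
  + exact: normal_last.
  + by move=> i /jump_succ/ram_sub.
- apply: lee_sum => i _; apply: dim_H1_inv_le.
    by move=> x; apply: derivation_act_lin.
  exact: (subspace_fixed derivation_act_lin subspace_TO).
Qed.

(* With a single jump [H] is trivial, and inflation is an isomorphism. *)
Lemma jump_dim_eq : f = 1%N ->
  dim_H1_quot rho (ram rho 1) (ram rho (u f.-1)) = dim_H1_TO rho.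
Proof.
move=> ->; rewrite (jump_end jumps).
exact: (dim_H1_quot1 derivation_act_lin derivation_act1 derivation_actM
  subspace_TO derivation_act_TO (ram_group 1)).
Qed.

End Jumps.
End RamificationGroups.

(** * An action of Z/p with a single jump *)

Section Substitution.
Variable k : fieldType.
Implicit Types a b : fps k.
Local Notation X := (fps_var k).

Definition fps_subst b a : fps k :=
  fps_series (fun i => fps_const (fcoef a i) * b ^+ i).

(** Each use of the recursion extracts a factor [b] from [phi a - psi a]. This identifies composites
    of substitutions without computing coefficients. *)
Lemma fps_subst_unique b (phi psi : fps k -> fps k) : xdvd 1 b ->
  (forall a, phi a = fps_const (fcoef a 0) + b * phi (fps_tail a)) ->
  (forall a, psi a = fps_const (fcoef a 0) + b * psi (fps_tail a)) ->
  phi =1 psi.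
Proof.
move=> db phiE psiE a; apply/eqP; rewrite -subr_eq0; apply/eqP/xdvd_eq0 => n.
elim: n a => [//|n IHn] a; rewrite phiE psiE opprD addrACA subrr add0r -mulrBr.
by rewrite -add1n; apply: xdvdM.
Qed.

Lemma fcoef_substE b a n :
  fcoef (fps_subst b a) n = \sum_(i < n.+1) fcoef a i * fcoef (b ^+ i) n.
Proof.
rewrite /= fcoef_sum; apply: eq_bigr => i _; rewrite fcoefM big_ord_recl /= subn0.
by rewrite mulr1n big1 ?addr0 // => j _; rewrite mulr0n mul0r.
Qed.

Lemma fps_substD b : {morph fps_subst b : a1 a2 / a1 + a2}.
Proof.
move=> a1 a2; apply: fpsP => n; rewrite fcoefD !fcoef_substE -big_split /=.
by apply: eq_bigr => i _; rewrite mulrDl.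
Qed.

Lemma fcoef_constM (c : k) a n : fcoef (fps_const c * a) n = c * fcoef a n.
Proof.
rewrite fcoefM big_ord_recl /= subn0 mulr1n.
by rewrite big1 ?addr0 // => j _; rewrite mulr0n mul0r.
Qed.

Lemma fps_subst_constM b c a :
  fps_subst b (fps_const c * a) = fps_const c * fps_subst b a.
Proof.
apply: fpsP => n; rewrite fcoef_constM !fcoef_substE mulr_sumr.
by apply: eq_bigr => i _; rewrite fcoef_constM mulrA.
Qed.

Section Positive.
Variable b : fps k.
Hypothesis db : xdvd 1 b.

Lemma fps_substXM a : fps_subst b (X * a) = b * fps_subst b a.
Proof.
apply/eqP; rewrite -subr_eq0; apply/eqP/xdvd_eq0 => n.
have ds (a' : fps k) i : xdvd i (fps_const (fcoef a' i) * b ^+ i).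
  by apply: xdvdMl; apply: xdvdX.
(* The term of index 0 for [X * a] is zero and the others are shifted, so [n.+1] terms on that side
   match [n] terms on the other. *)
have := xdvdMl b (fps_seriesP (n := n) (ds a)).
have := xdvd_leq (leqnSn n) (fps_seriesP (n := n.+1) (ds (X * a))).
rewrite -/(fps_subst b a) -/(fps_subst b (X * a)) big_ord_recl fcoefXM rmorph0.
rewrite mul0r add0r mulrBr => d1 d2; have := xdvdB d1 d2.
have <- : b * (\sum_(i < n) fps_const (fcoef a i) * b ^+ i) =
    \sum_(i < n) fps_const (fcoef (X * a) (lift ord0 i)) * b ^+ lift ord0 i.
  rewrite mulr_sumr; apply: eq_bigr => i _.
  by rewrite fcoefXM lift0 /= exprS mulrCA.
by rewrite opprB addrA subrK.
Qed.

Lemma fps_substC c : fps_subst b (fps_const c) = fps_const c.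
Proof.
apply: fpsP => n; rewrite fcoef_substE big_ord_recl big1 => [|i _].
  by rewrite addr0 expr0 fcoef1 /= mulr1n mulr_natr.
by rewrite /= mulr0n mul0r.
Qed.

Lemma fps_subst_headtail a :
  fps_subst b a = fps_const (fcoef a 0) + b * fps_subst b (fps_tail a).
Proof. by rewrite {1}[a]fps_headtail fps_substD fps_substC fps_substXM. Qed.

Lemma fps_substX : fps_subst b X = b.
Proof.
by rewrite -[X]mulr1 fps_substXM -(rmorph1 (@fps_const k)) fps_substC rmorph1 mulr1.
Qed.

Lemma fps_substM : {morph fps_subst b : a1 a2 / a1 * a2}.
Proof.
move=> a1 a2; apply/eqP; rewrite -subr_eq0; apply/eqP/xdvd_eq0 => n.
elim: n a1 => [//|n IHn] a1.
rewrite [X in fps_subst b (X * _)]fps_headtail mulrDl fps_substD fps_subst_constM.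
rewrite -mulrA fps_substXM [fps_subst b a1]fps_subst_headtail mulrDl opprD.
rewrite addrACA subrr add0r -mulrA -mulrBr -add1n.
exact: xdvdM.
Qed.

Lemma fps_subst_xdvd n a : xdvd n a -> xdvd n (fps_subst b a).
Proof.
move=> da m lt_mn; rewrite fcoef_substE big1 // => i _.
by rewrite da ?mul0r // (leq_ltn_trans _ lt_mn) // -ltnS.
Qed.

End Positive.

Lemma fps_subst_comp b b' a : xdvd 1 b -> xdvd 1 b' ->
  fps_subst b (fps_subst b' a) = fps_subst (fps_subst b b') a.
Proof.
move=> db db'; move: a; apply: (@fps_subst_unique (fps_subst b b')).
- exact: fps_subst_xdvd.
- move=> a; rewrite {1}(fps_subst_headtail db') fps_substD fps_substC //.
  by rewrite fps_substM.
- by move=> a; apply: fps_subst_headtail; apply: fps_subst_xdvd.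
Qed.

Lemma fps_subst_id a : fps_subst X a = a.
Proof.
move: a; apply: (@fps_subst_unique X) => [[]//|a|a]; last exact: fps_headtail.
by apply: fps_subst_headtail => -[].
Qed.

(** [t / (1 - c t)] *)
Definition homog c : fps k := X / (1 - fps_const c * X).

Lemma homogP c : homog c * (1 - fps_const c * X) = X.
Proof.
rewrite /homog divrK //; apply/unitrP.
have [|b bE] := @fps_unit_coef0 k (1 - fps_const c * X).
  by rewrite fcoefD fcoefN fcoef_constM fcoef1 /= mulr0 subr0 oner_eq0.
by exists b; rewrite [_ * b]mulrC.
Qed.

Lemma homogE c : homog c = X + fps_const c * X * homog c.
Proof.
by apply/eqP; rewrite -subr_eq [_ * homog c]mulrC -{1}[homog c]mulr1 -mulrBr homogP.
Qed.

Lemma homog_xdvd c : xdvd 1 (homog c).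
Proof. by move=> [|//] _; rewrite /homog fcoefM big_ord1 /= mul0r. Qed.

Lemma homog_unique c b : b * (1 - fps_const c * X) = X -> b = homog c.
Proof.
move=> bE; have nz : 1 - fps_const c * X != 0.
  apply/eqP => e; move: bE; rewrite e mulr0.
  by move/(congr1 (fun a => fcoef a 1))/eqP; rewrite /= eq_sym oner_eq0.
by apply: (mulIf nz); rewrite bE homogP.
Qed.

Lemma homog0 : homog 0 = X.
Proof. by apply/esym/homog_unique; rewrite rmorph0 mul0r subr0 mulr1. Qed.

(** Composition of translations in the coordinate [1 / X]: substitute [homog d] into the equation
    defining [homog c], then multiply by [1 - d X]. *)
Lemma homogD c d : fps_subst (homog d) (homog c) = homog (c + d).
Proof.
have dd := homog_xdvd d; apply: homog_unique.
have := congr1 (fps_subst (homog d)) (homogP c).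
rewrite fps_substM // fps_substD -mulN1r -(rmorph1 (@fps_const k)) -rmorphN.
rewrite !fps_subst_constM !fps_substC // fps_substX // rmorphN rmorph1 mulN1r => e.
rewrite -[RHS](homogP d) -{2}e rmorphD /= -mulrA; congr (_ * _).
rewrite mulrBl mul1r -mulrA homogP; ring.
Qed.

Lemma homog_coef1 c : fcoef (homog c) 1 = 1.
Proof.
rewrite homogE fcoefD -mulrA fcoef_constM fcoefXM (homog_xdvd c) //.
by rewrite mulr0 addr0.
Qed.

Lemma homog_coef2 c : fcoef (homog c) 2 = c.
Proof.
by rewrite homogE fcoefD -mulrA fcoef_constM fcoefXM homog_coef1 mulr1 add0r.
Qed.

End Substitution.

Section HomographicAutomorphism.
Variable k : fieldType.
Local Notation L := (laurent k).
Local Notation t := (tvar k).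
Local Notation sub c := (fps_subst (homog c)).
Implicit Types (c d : k) (a b : fps k) (x y : L).

Lemma sub_homogD c d a : sub d (sub c a) = sub (c + d) a.
Proof.
by rewrite fps_subst_comp ?homogD //; apply: homog_xdvd.
Qed.

(** Injectivity keeps denominators nonzero when the substitution is extended to fractions. *)
Lemma sub_homog_inj c : injective (sub c).
Proof.
move=> a b /(congr1 (sub (- c))).
by rewrite !sub_homogD subrr homog0 !fps_subst_id.
Qed.

Lemma sub_homog1 c : sub c 1 = 1.
Proof. by rewrite -(rmorph1 (@fps_const k)) fps_substC. Qed.

Lemma sub_homog_eq0 c a : (sub c a == 0) = (a == 0).
Proof.
have {1}<- : sub c 0 = 0 by rewrite -(rmorph0 (@fps_const k)) fps_substC.
exact: inj_eq (@sub_homog_inj c) _ _.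
Qed.

Definition homog_act c (x : L) : L :=
  of_fps (sub c (num x)) / of_fps (sub c (den x)).

Lemma homog_actE c a b : b != 0 ->
  homog_act c (of_fps a / of_fps b) = of_fps (sub c a) / of_fps (sub c b).
Proof.
move=> b0; have d0 := den_neq0 (of_fps a / of_fps b); rewrite /homog_act; apply/eqP.
have nz (e : fps k) : e != 0 -> of_fps (sub c e) != 0.
  by rewrite of_fps_eq0 sub_homog_eq0.
rewrite eqr_div ?nz // -!rmorphM -!fps_substM; try exact: homog_xdvd.
apply/eqP; congr (of_fps (sub c _)); apply: of_fps_inj; rewrite !rmorphM /=.
apply/eqP; rewrite -eqr_div ?of_fps_eq0 //; apply/eqP.
by rewrite -num_den.
Qed.

Lemma homog_act_fps c a : homog_act c (of_fps a) = of_fps (sub c a).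
Proof.
have := @homog_actE c a 1 (oner_neq0 _).
by rewrite sub_homog1 !rmorph1 !divr1.
Qed.

Fact homog_act_is_zmod_morphism c : zmod_morphism (homog_act c).
Proof.
move=> x y; rewrite [x]num_den [y]num_den.
move: (num x) (den x) (num y) (den y) (den_neq0 x) (den_neq0 y) => a b a' b' b0 b'0.
rewrite -mulNr addf_div ?of_fps_eq0 // -!rmorphN -!rmorphM -rmorphD.
rewrite !homog_actE ?mulf_neq0 // -mulNr addf_div ?of_fps_eq0 ?sub_homog_eq0 //.
have dc := homog_xdvd c; rewrite !fps_substM // !fps_substD !fps_substM //.
have -> : sub c (- a') = - sub c a'.
  by apply/eqP; rewrite -addr_eq0 -fps_substD addNr sub_homog_eq0.
by rewrite rmorphD !rmorphM rmorphN.
Qed.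

Fact homog_act_is_monoid_morphism c : monoid_morphism (homog_act c).
Proof.
split; first by rewrite -(rmorph1 (@of_fps k)) homog_act_fps sub_homog1.
move=> x y; rewrite [x]num_den [y]num_den.
move: (num x) (den x) (num y) (den y) (den_neq0 x) (den_neq0 y) => a b a' b' b0 b'0.
rewrite mulf_div -!rmorphM !homog_actE ?mulf_neq0 //.
by rewrite !fps_substM ?rmorphM ?mulf_div //; apply: homog_xdvd.
Qed.

HB.instance Definition _ c :=
  GRing.isZmodMorphism.Build L L (homog_act c) (homog_act_is_zmod_morphism c).
HB.instance Definition _ c :=
  GRing.isMonoidMorphism.Build L L (homog_act c) (homog_act_is_monoid_morphism c).

Fact homog_act_is_scalable c : scalable (homog_act c).
Proof.
move=> z x; rewrite -[z *: x]/(of_fps (fps_const z) * x) rmorphM /=.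
by rewrite homog_act_fps fps_substC.
Qed.
HB.instance Definition _ c :=
  GRing.isScalable.Build k L L *:%R (homog_act c) (homog_act_is_scalable c).

Lemma homog_act0 x : homog_act 0 x = x.
Proof. by rewrite /homog_act homog0 !fps_subst_id -num_den. Qed.

Lemma homog_actD c d x : homog_act (c + d) x = homog_act c (homog_act d x).
Proof.
have b0 : sub d (den x) != 0 by rewrite sub_homog_eq0 den_neq0.
apply: (etrans _ (esym (homog_actE c (sub d (num x)) b0))).
by rewrite !sub_homogD [d + c]addrC.
Qed.

Lemma homog_act_tvar c : homog_act c t = of_fps (homog c).
Proof. by rewrite homog_act_fps fps_substX //; apply: homog_xdvd. Qed.

Lemma homog_act_tO c n x : tO n x -> tO n (homog_act c x).
Proof.
move=> /tOP[a -> da]; rewrite homog_act_fps; apply/tO_of_fps.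
by apply: fps_subst_xdvd => //; apply: homog_xdvd.
Qed.

Lemma continuous_of_tO (s : {rmorphism L -> L}) :
  (forall n x, tO n x -> tO n (s x)) -> continuous_t s.
Proof.
move=> sO x n; exists `|n|%N => y /val_ge_tO/sO/val_ge_tO; rewrite rmorphB.
by apply: le_trans; rewrite lee_fin; lia.
Qed.

Lemma homog_act_displacement c i :
  tO i (homog_act c t - t) <-> (c != 0 -> (i <= 2)%N).
Proof.
rewrite homog_act_tvar -rmorphB tO_of_fps.
have -> : homog c - fps_var k = fps_const c * (fps_var k * homog c).
  by rewrite {1}homogE addrAC subrr add0r mulrA.
have [->|c0] := eqVneq c 0.
  by rewrite rmorph0 mul0r; split=> // _; apply: xdvd0.
split=> [di _|/(_ isT) le_i2].
  rewrite leqNgt; apply: contra c0 => lt_2i; have := di _ lt_2i.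
  by rewrite fcoef_constM fcoefXM homog_coef1 mulr1 => ->.
apply: (xdvd_leq le_i2); apply: xdvdMl; rewrite -[2%N]/(1 + 1)%N.
by apply: xdvdM; [move=> [] | apply: homog_xdvd].
Qed.

End HomographicAutomorphism.

(** * The invariants of a finite group form a local subfield *)

Section FixedField.
Variables (k : fieldType) (gT : finGroupType).
Local Notation L := (laurent k).
Local Notation t := (tvar k).
Variable rho : gT -> {lrmorphism L -> L}.
Hypothesis rhoM : forall g h x, rho (g * h)%g x = rho g (rho h x).
Hypothesis rho_tO : forall g n x, tO n x -> tO n (rho g x).

Definition fixed_field : {pred L} := fun x => `[< forall g, rho g x = x >].

Lemma fixed_fieldP x : x \in fixed_field <-> forall g, rho g x = x.
Proof. by rewrite unfold_in; split=> /asboolP. Qed.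

Lemma rho_mulV g x : x != 0 -> rho g x * rho g x^-1 = 1.
Proof. by move=> x0; rewrite -rmorphM mulfV ?rmorph1. Qed.

Lemma rho_neq0 g x : x != 0 -> rho g x != 0.
Proof.
move=> /(@rho_mulV g) e; apply: contra_eqN e => /eqP ->.
by rewrite mul0r eq_sym oner_eq0.
Qed.

Lemma rho_inv g x : rho g x^-1 = (rho g x)^-1.
Proof.
have [->|x0] := eqVneq x 0; first by rewrite invr0 rmorph0 invr0.
by apply/esym/mulr1_eq; apply: rho_mulV.
Qed.

Lemma fixed_field_closed : divring_closed fixed_field.
Proof.
split=> [|x y /fixed_fieldP fx /fixed_fieldP fy|
  x y /fixed_fieldP fx /fixed_fieldP fy]; apply/fixed_fieldP => g.
- exact: rmorph1.
- by rewrite rmorphB /= fx fy.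
- by rewrite rmorphM /= rho_inv fx fy.
Qed.

Lemma fixed_field_nontrivial :
  exists2 x, x \in fixed_field & x != 0 /\ val_t x != 0%E.
Proof.
(* The norm of [t]: invariant as a product over the group, and of positive valuation like each
   factor. *)
exists (\prod_g rho g t).
  apply/fixed_fieldP => g; rewrite rmorph_prod [RHS](reindex_inj (mulgI g)) /=.
  by apply: eq_bigr => h _; rewrite rhoM.
have d1 : tO 1 (\prod_g rho g t).
  rewrite (bigD1 1%g) //= -[1%N]addn0; apply: tOM.
    by apply: rho_tO; apply: tO_tvar.
  apply: (big_ind (fun x => tO 0 x)) => [|x y|g _].
  - by apply/tO0P; exists 1; rewrite rmorph1.
  - exact: tOMl.
  - by apply: rho_tO; apply: (@tO_leq _ 0 1) => //; apply: tO_tvar.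
split; first by apply/prodf_neq0 => g _; exact/rho_neq0/tvar_neq0.
apply/eqP => e; move/val_ge_tO: d1; rewrite e.
by rewrite lee_fin.
Qed.

(** From index [N 0] on, [u] differs from [u (N 0)] by a power series whose coefficient of degree
    [m] is stationary from [M m] on; the limit collects these stationary values. *)
Lemma laurent_complete (u : nat -> L) : cauchy_t u -> exists l, converges_t u l.
Proof.
move=> cu.
have /choice[N NP] : forall n : nat, exists N, forall i j,
    (N <= i)%N -> (N <= j)%N -> tO n (u i - u j).
  by move=> n; have [N NP] := cu n; exists N => i j Ni Nj; apply/val_ge_tO/NP.
have /choice[a aP] : forall i, exists a,
    (N 0 <= i)%N -> u i - u (N 0) = of_fps a.
  move=> i; have [le_Ni|lt_iN] := leqP (N 0) i; last by exists 0.
  by have /tO0P[a ea] := NP 0 _ _ le_Ni (leqnn _); exists a.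
pose M m := maxn (N 0) (N m.+1).
pose l := FPS (fun m => fcoef (a (M m)) m).
exists (u (N 0) + of_fps l) => n; exists (maxn (N 0) (\max_(m < `|n|.+1) M m)) => i.
rewrite geq_max => /andP[N0i /bigmax_leqP Mi].
apply: (@le_trans _ _ (`|n|%N%:Z)%:E); first by rewrite lee_fin; lia.
apply/val_ge_tO; rewrite opprD addrA aP // -rmorphB; apply/tO_of_fps => m lt_mn.
have lt_mn1 : (m < `|n|.+1)%N by apply: ltnW.
have /= Mmi := Mi (Ordinal lt_mn1) isT.
have N0M : (N 0 <= M m)%N by apply: leq_maxl.
have NmM : (N m.+1 <= M m)%N by apply: leq_maxr.
have := NP m.+1 _ _ (leq_trans NmM Mmi) NmM.
rewrite -(subrKA (u (N 0))) -[u (N 0) - _]opprB !aP // -rmorphB => /tO_of_fps.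
by apply.
Qed.

Lemma fixed_field_local : local_subfield fixed_field.
Proof.
split; [exact: fixed_field_closed | exact: fixed_field_nontrivial |].
move=> u Ku cu; have [l ul] := laurent_complete cu; exists l => //.
apply/fixed_fieldP => g; apply/eqP; rewrite -subr_eq0; apply/eqP/tO_eq0 => n.
have [N NP] := ul n; have /val_ge_tO d := NP N (leqnn N).
have := rho_tO g d; rewrite rmorphB /= ((fixed_fieldP _).1 (Ku N)) => /tON dg.
by have := tOD d dg; rewrite opprB addrC subrKA.
Qed.

End FixedField.

(** Every finite list [r] in an algebraically closed field leaves out an element, namely a nonroot
    of [\prod_(y <- r) ('X - y%:P)]; so there are more constants than roots of [P]. *)
Lemma exists_nonroot (K : closedFieldType) (F : fieldType)
  (i : {rmorphism K -> F}) (P : {poly F}) : P != 0 -> exists x, ~~ root P (i x).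
Proof.
have /(_ (size P))[r sr ur] : forall n, exists2 r : seq K, size r = n & uniq r.
  elim=> [|n [r sr ur]]; first by exists [::].
  have /closed_nonrootP[x] : \prod_(y <- r) ('X - y%:P) != 0 :> {poly K}.
    by apply: monic_neq0; apply: monic_prod_XsubC.
  by rewrite root_prod_XsubC => xr; exists (x :: r); rewrite /= ?sr ?xr.
move=> P0; apply: contrapT => none.
have := @max_poly_roots _ P (map i r) P0.
rewrite size_map sr ltnn map_inj_uniq ?ur; last exact: fmorph_inj.
move=> h; suff : false by []; apply: h => //.
by apply/allP => _ /mapP[x _ ->]; apply: contrapT => /negP nx; apply: none; exists x.
Qed.

(** * Artin's theorem: automorphisms over the fixed field come from the group *)

Section Artin.
Variables (k : closedFieldType) (gT : finGroupType).
Local Notation L := (laurent k).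
Variable rho : gT -> {lrmorphism L -> L}.
Hypothesis rho1 : forall x, rho 1%g x = x.
Hypothesis rhoM : forall g h x, rho (g * h)%g x = rho g (rho h x).

(* [s x] is a conjugate [rho g x] for each [x], because [\prod_g ('X - rho g x)]
   is fixed by [s]; the infinite field [k] of constants makes [g] independent
   of [x]. *)
Lemma artin_conjugate (s : {rmorphism L -> L}) :
  {in fixed_field rho, forall x, s x = x} -> exists g, s =1 rho g.
Proof.
move=> sK; apply: contrapT => none.
have /choice[x xP] g : exists x, s x != rho g x.
  apply: contrapT => h; apply: none; exists g => x.
  by apply/eqP/negPn/negP => nx; apply: h; exists x.
(* At a constant [c], [P h] takes the value [s y - rho h y] for [y = \sum_g x g * c ^+ enum_rank g].
   Its coefficient of index [enum_rank h] is nonzero by the choice of [x h], so some [c] avoids all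
   roots and [s y] differs from every conjugate of [y]. *)
pose P h : {poly L} := \sum_g (s (x g) - rho h (x g)) *: 'X^(enum_rank g).
have P0 h : P h != 0.
  apply: contraNneq (xP h) => Ph0; rewrite -subr_eq0.
  have := congr1 (fun Q : {poly L} => Q`_(enum_rank h)) Ph0.
  rewrite coef_sum (bigD1 h) //= coefZ coefXn eqxx mulr1 coef0 big1 ?addr0.
    by move=> ->.
  move=> g gh; rewrite coefZ coefXn; case: eqP => [|_]; last by rewrite mulr0.
  by move=> /ord_inj/enum_rank_inj e; rewrite e eqxx in gh.
have [z] : exists z, ~~ root (\prod_h P h) (of_fps (fps_const z)).
  apply: (exists_nonroot (@of_fps k \o @fps_const k)).
  by apply/prodf_neq0.
set c := of_fps _; rewrite rootE horner_prod => /prodf_neq0 Pz.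
have fixc h : rho h c = c by exact: fix_const.
have sc : s c = c by apply/sK/fixed_fieldP.
have [y sy] : exists y, forall h, s y != rho h y.
  exists (\sum_g x g * c ^+ enum_rank g) => h.
  rewrite -subr_eq0 !rmorph_sum -sumrB; have := Pz h isT; rewrite horner_sum.
  congr (_ != _); apply: eq_bigr => g _.
  by rewrite hornerZ hornerXn !rmorphM !rmorphXn /= sc fixc mulrBl.
pose Q := \prod_h ('X - (rho h y)%:P).
have fixQ g : map_poly (rho g) Q = Q.
  rewrite rmorph_prod [RHS](reindex_inj (mulgI g)) /=; apply: eq_bigr => h _.
  by rewrite rmorphB /= map_polyX map_polyC /= rhoM.
have sQ : map_poly s Q = Q.
  apply/polyP => i; rewrite coef_map; apply/sK/fixed_fieldP => g.
  by rewrite -{2}(fixQ g) coef_map.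
have Qy : Q.[y] = 0.
  rewrite horner_prod; apply/eqP/prodf_eq0; exists 1%g => //.
  by rewrite hornerXsubC rho1 subrr.
have : (map_poly s Q).[s y] == 0 by rewrite horner_map Qy rmorph0.
rewrite sQ horner_prod => /prodf_eq0[h _].
by rewrite hornerXsubC subr_eq0 (negPf (sy h)).
Qed.

End Artin.

Section Example.
Variables (k : closedFieldType) (p : nat) (p_char : p \in [pchar k]).
Local Notation L := (laurent k).
Local Notation t := (tvar k).

Definition Fp_scalar (g : 'F_p) : k := (nat_of_ord g)%:R.

Let p_prime : prime p. Proof. exact: GRing.pcharf_prime p_char. Qed.

Lemma Fp_scalarD g h : Fp_scalar (g + h) = Fp_scalar g + Fp_scalar h.
Proof.
rewrite /Fp_scalar -natrD -(GRing.natr_mod_pchar p_char (_ + _)%N); congr (_%:R).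
by congr (_ %% _)%N; apply: Fp_cast.
Qed.

Lemma Fp_scalar_eq0 g : (Fp_scalar g == 0) = (g == 0).
Proof.
rewrite /Fp_scalar -(GRing.dvdn_pcharf p_char) -[RHS]val_eqE /=.
have lt_gp : (g < p)%N by rewrite -[X in (_ < X)%N](Fp_cast p_prime).
by case: (posnP g) => [->|g0]; rewrite ?dvdn0 // gtnNdvd // gtn_eqF.
Qed.

Lemma Fp_scalar_inj : injective Fp_scalar.
Proof.
move=> g h e; apply/eqP; rewrite -subr_eq0 -Fp_scalar_eq0.
by rewrite -(inj_eq (addIr (Fp_scalar h))) -Fp_scalarD subrK add0r e.
Qed.

(** As a finite group ['F_p] carries its addition, so [g * h] is the sum and [1%g] is zero. *)
Definition homog_rho (g : 'F_p) : {lrmorphism L -> L} := homog_act (Fp_scalar g).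

Lemma homog_rho1 x : homog_rho 1%g x = x.
Proof. exact: homog_act0. Qed.

Lemma homog_rhoM g h x : homog_rho (g * h)%g x = homog_rho g (homog_rho h x).
Proof. by rewrite /homog_rho /= -homog_actD -Fp_scalarD. Qed.

Lemma homog_rho_tO g n x : tO n x -> tO n (homog_rho g x).
Proof. exact: homog_act_tO. Qed.

Lemma homog_rho_continuous g : continuous_t (homog_rho g).
Proof.
apply: (@continuous_of_tO _ (homog_act (Fp_scalar g))) => n x.
exact: homog_act_tO.
Qed.

Lemma homog_rho_faithful g h : homog_rho g =1 homog_rho h -> g = h.
Proof.
move=> /(_ t); rewrite /homog_rho /= !homog_act_tvar => /of_fps_inj e.
by apply: Fp_scalar_inj; rewrite -[LHS]homog_coef2 e homog_coef2.
Qed.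

Lemma homog_ram i :
  ram homog_rho i = if (i <= 1)%N then [set: 'F_p] else [set 1%g].
Proof.
apply/setP => g; apply/ramP/idP => [/homog_act_displacement|].
  rewrite Fp_scalar_eq0; case: ifP => [_ _|/negbT]; first by rewrite inE.
  by rewrite inE -ltnNge => lt_1i gP; apply: contraLR lt_1i => /gP; rewrite -leqNgt.
move=> gi; apply/homog_act_displacement; rewrite Fp_scalar_eq0; move: gi.
by case: ifP => // _; rewrite inE => /eqP ->; rewrite eqxx.
Qed.

(** The single jump is 1; the value 2 at index 0 is the convention [t 0 = t 1 + 1]. *)
Definition homog_jump (i : nat) : nat := if i is 0 then 2 else 1.

Lemma homog_jump_sequence : jump_sequence homog_rho 1 homog_jump.
Proof.
have nl l : (1 <= l < 1)%N = false by case: l => [|[]].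
split=> //; first by move=> i /andP[i1 i2]; congr ram; apply/anti_leq/andP.
- by move=> l; rewrite nl.
- by move=> l; rewrite nl.
- move=> [//|[|//]] _; rewrite !homog_ram /= properE finset.sub1set inE /=.
  apply/negP => /fintype.subsetP/(_ (1 : 'F_p)); rewrite !inE => /(_ isT).
  by rewrite (oner_eq0 'F_p).
- exact: homog_ram.
Qed.

Lemma homog_galois : galois_group homog_rho (fixed_field homog_rho).
Proof.
split.
- exact: homog_rho1.
- exact: homog_rhoM.
- exact: homog_rho_faithful.
- exact: homog_rho_continuous.
- exact: fixed_fieldP.
- by move=> s _ sK; apply: artin_conjugate homog_rho1 homog_rhoM _ sK.
Qed.

Lemma homog_local : local_subfield (fixed_field homog_rho).
Proof. exact: (fixed_field_local homog_rhoM homog_rho_tO). Qed.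

Lemma homog_dim_eq :
  dim_H1_quot homog_rho (ram homog_rho 1) (ram homog_rho (homog_jump 0)) =
  dim_H1_TO homog_rho.
Proof.
exact: (jump_dim_eq homog_rho1 homog_rhoM homog_rho_continuous
  homog_jump_sequence erefl).
Qed.

End Example.

Theorem proposition2p9 (k : closedFieldType) (p : nat)
    (p_char : p \in [pchar k]) (p_ge5 : (5 <= p)%N) :
  (forall (gT : finGroupType) (rho : gT -> {lrmorphism laurent k -> laurent k})
      (K : {pred laurent k}) (f : nat) (t : nat -> nat),
    local_subfield K -> galois_group rho K -> jump_sequence rho f t ->
    [/\ (dim_H1_quot rho (ram rho 1) (ram rho (t f.-1)) <= dim_H1_TO rho)%E,
        (dim_H1_TO rho <=
           \sum_(1 <= i < f.+1)
             dim_H1_quot_inv rho (ram rho (t f)) (ram rho (t i))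
               (ram rho (t i.-1)))%E
      & (\sum_(1 <= i < f.+1)
           dim_H1_quot_inv rho (ram rho (t f)) (ram rho (t i))
             (ram rho (t i.-1)) <=
         \sum_(1 <= i < f.+1)
           dim_H1_quot rho (ram rho (t i)) (ram rho (t i.-1)))%E]) /\
  (exists (gT : finGroupType) (rho : gT -> {lrmorphism laurent k -> laurent k})
      (K : {pred laurent k}) (f : nat) (t : nat -> nat),
    [/\ local_subfield K, galois_group rho K, jump_sequence rho f t
      & dim_H1_quot rho (ram rho 1) (ram rho (t f.-1)) = dim_H1_TO rho]).
Proof.
split=> [gT rho K f t _ galK jumps|].
  exact: (jump_dim_bounds (galois_act1 galK) (galois_actM galK)
    (galois_continuous galK) jumps).
exists _, (@homog_rho k p), (fixed_field (@homog_rho k p)), 1, homog_jump.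
split; [exact: homog_local | exact: homog_galois | exact: homog_jump_sequence |].
exact: homog_dim_eq.
Qed.
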